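(* Let $m$ be a positive integer and let $\pm\theta_1,\pm\theta_2,\pm\theta_3$ be the roots of $q(x)=x^6-(m+5)x^4+(3m+5)x^2-1$ in its splitting field over $\mathbb{Q}$. In the double subdivided star $T_{2,m}$, let $c,d$ be the two pendant vertices of the subdivided star $SK_{1,2}$ part and $e,f$ their respective neighbours (the two degree-$2$ vertices adjacent to the coalescence vertex of $SK_{1,2}$). Then: (1) If $q(x)$ is irreducible over $\mathbb{Q}$, then $T_{2,m}$ has pretty good state transfer between $c$ and $d$ and between $e$ and $f$, with respect to a sequence in $(2\mathbb{Z}+1)\pi$. (2) Suppose $q(x)$ is reducible over $\mathbb{Q}$. If $\theta_1+\theta_2+\theta_3$ is an even integer, then $T_{2,m}$ has pretty good state transfer between $c$ and $d$ and between $e$ and $f$, with respect to a sequence in $(2\mathbb{Z}+1)\pi$. If $\theta_1+\theta_2+\theta_3$ is an odd integer, then there is no pretty good state transfer from any of the vertices $c,d,e,f$.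
   Context: A subdivided star $SK_{1,l}$ is obtained by identifying exactly one pendant (end) vertex from each of $l$ copies of the path $P_3$; the identified vertex is the coalescence vertex. The double subdivided star $T_{l,m}$ is obtained from $SK_{1,l}$ and $SK_{1,m}$ by adding one edge joining their two coalescence vertices. For a graph with adjacency matrix $A$, $U(t)=\exp(itA)$, $t\in\mathbb{R}$, and $\mathbf{e}_a$ is the standard basis vector of vertex $a$. Pretty good state transfer between distinct vertices $a,b$ means there exist real $\tau_k$ and $\gamma\in\mathbb{C}$ with $\lim_{k\to\infty}U(\tau_k)\mathbf{e}_a=\gamma\mathbf{e}_b$; ''with respect to a sequence in $S$'' means such $\tau_k$ can be chosen in $S$. When $q$ is reducible, it factors as $-f(x)f(-x)$ with $f$ an irreducible monic cubic, and $\theta_1,\theta_2,\theta_3$ denote the roots of $f$ (so $\theta_1+\theta_2+\theta_3$ is an integer). *)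

(* Defs.v *)
From HB Require Import structures.
From mathcomp Require Import all_boot all_order all_algebra.
From mathcomp Require Import algC.
From mathcomp Require Import all_classical all_reals.
From mathcomp Require Import topology normedtype sequences trigo.
From mathcomp Require Import complex.

Set Implicit Arguments.
Unset Strict Implicit.
Unset Printing Implicit Defensive.

Import Order.TTheory GRing.Theory Num.Theory numFieldNormedType.Exports.
Local Open Scope ring_scope.
Local Open Scope classical_set_scope.

(* Vertex numbering of T_{2,m} (2m+6 vertices):
     0 = c, 1 = d       : pendant vertices of SK_{1,2}
     2 = e, 3 = f       : neighbours of c and d (degree 2)
     4 = u              : coalescence vertex of SK_{1,2}
     5 = v              : coalescence vertex of SK_{1,m}
     6+2i, 7+2i (i<m)   : the i-th P_3 branch of SK_{1,m}: v - (6+2i) - (7+2i)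
   Edges: c-e, d-f, e-u, f-u, u-v, v-(6+2i), (6+2i)-(7+2i). *)

Definition nverts (m : nat) : nat := (m.*2).+4.+2.

Definition tedge (m x y : nat) : bool :=
  [|| (x == 0) && (y == 2), (x == 1) && (y == 3), (x == 2) && (y == 4),
      (x == 3) && (y == 4), (x == 4) && (y == 5),
      (x == 5) && [&& 6 <= y, y < nverts m & ~~ odd y]
    | [&& 6 <= x, x < nverts m, ~~ odd x & y == x.+1] ]%N.

Definition tadj (m x y : nat) : bool := tedge m x y || tedge m y x.

Definition adjT (R : realType) (m : nat) : 'M[R[i]]_(nverts m) :=
  \matrix_(x, y) (tadj m x y)%:R.

Definition vc (m : nat) : 'I_(nverts m) := inord 0.
Definition vd (m : nat) : 'I_(nverts m) := inord 1.
Definition ve (m : nat) : 'I_(nverts m) := inord 2.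
Definition vf (m : nat) : 'I_(nverts m) := inord 3.

Definition ccvg (R : realType) (z : nat -> R[i]) (w : R[i]) : Prop :=
  ((fun k => complex.Re (z k)) @ \oo --> complex.Re w) /\
  ((fun k => complex.Im (z k)) @ \oo --> complex.Im w).

Definition climit (R : realType) (z : nat -> R[i]) : R[i] :=
  Complex (lim ((fun k => complex.Re (z k)) @ \oo))
          (lim ((fun k => complex.Im (z k)) @ \oo)).

Definition expSum (R : realType) (n : nat) (A : 'M[R[i]]_n) (t : R) (N : nat)
  : 'M[R[i]]_n :=
  \sum_(k < N) ((Complex 0 t) ^+ k / (k`!)%:R) *: A ^+ k.

Definition Umat (R : realType) (n : nat) (A : 'M[R[i]]_n) (t : R) : 'M[R[i]]_n :=
  \matrix_(x, y) climit (fun N => expSum A t N x y).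

(* pretty good state transfer from a to b with respect to a sequence in S:
   lim_k U(tau_k) e_a = gamma e_b, i.e. entrywise on the column a. *)
Definition pgst_wrt (R : realType) (n : nat) (A : 'M[R[i]]_n) (S : set R)
  (a b : 'I_n) : Prop :=
  exists tau : nat -> R, (forall k, S (tau k)) /\
  exists gamma : R[i], forall x : 'I_n,
    ccvg (fun k => Umat A (tau k) x a) (if x == b then gamma else 0).

Definition pgst (R : realType) (n : nat) (A : 'M[R[i]]_n) (a b : 'I_n) : Prop :=
  pgst_wrt A setT a b.

Definition oddpi (R : realType) : set R :=
  [set t | exists z : int, t = (z *+ 2 + 1)%:~R * pi].

Definition q_T2m (m : nat) : {poly rat} :=
  'X^6 - (m + 5)%:R *: 'X^4 + (3 * m + 5)%:R *: 'X^2 - 1.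

Arguments adjT R m : clear implicits.
Arguments oddpi R : clear implicits.

(* Main.v *)
Require Import Defs.
From HB Require Import structures.
From mathcomp Require Import all_boot all_order all_algebra.
From mathcomp Require Import algC separable.
From mathcomp Require Import all_classical all_reals.
From mathcomp Require Import topology normedtype sequences trigo realfun.
From mathcomp Require Import complex zify ring lra.
Import Order.TTheory GRing.Theory Num.Theory.
Import numFieldNormedType.Exports.
Local Open Scope ring_scope.

Set Implicit Arguments.
Unset Strict Implicit.
Unset Printing Implicit Defensive.

(** The space of states splits under the swap of the two branches of [SK_{1,2}].
    On the antisymmetric part the adjacency matrix has eigenvalues [1] and [-1],
    so [U(t)] acts there as [-1] at odd multiples of [pi].  The symmetric part
    is spanned, as far as [c + d] and [e + f] are concerned, by eigenvectors for
    the six roots of [q].  Transfer at times in [(2Z+1) pi] thus amounts to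
    finding odd [k] such that [k theta] is close to an even integer for every
    root [theta].  By Kronecker's theorem this is possible as soon as an integer
    that is an integral combination of the roots is always even.  Taking
    traces in such a relation gives [0] when [q] is irreducible, and
    [3 n = (sum l_j) (theta_1 + theta_2 + theta_3)] when [q = - f(x) f(-x)].
    Conversely, if [theta_1 + theta_2 + theta_3] is odd then this relation
    contradicts the limits that transfer from [c] to [d] imposes on
    [exp(i tau)] and [exp(i tau theta_j)], while transfer between the other
    vertices forces [theta ^ 2 = 1], although [q(1) = q(-1) = 2 m]. *)

(** * Traces of algebraic numbers *)

(** A nonconstant [p] has a root in [algC], shared with the irreducible [q], so [q] divides [p]; the
    quotient satisfies the same hypotheses and is smaller. *)
Lemma monic_power_irreducible (p q : {poly rat}) :
  p \is monic -> q \is monic -> irreducible_poly q ->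
  (forall x : algC, root (map_poly ratr p) x -> root (map_poly ratr q) x) ->
  exists k, p = q ^+ k.
Proof.
move=> p_mon q_mon q_irr; have [s] := ubnP (size p).
elim: s p p_mon => // s IHs p p_mon; rewrite ltnS => size_p rpq.
have [p_const|p_nconst] := eqVneq (size p) 1%N.
  exists 0; rewrite expr0; move/eqP/size_poly1P: p_const => [c _ Dp].
  by move: p_mon; rewrite Dp monicE lead_coefC => /eqP->.
have [x px0]: exists x : algC, root (map_poly ratr p) x.
  by apply/closed_rootP; rewrite size_map_poly.
have qp : q %| p.
  apply: contraT; rewrite -irreducible_poly_coprime // => cqp.
  have: coprimep (map_poly ratr q) (map_poly ratr p : {poly algC}).
    by rewrite coprimep_map.
  move/coprimep_root => /(_ x (rpq x px0)).
  by rewrite (rootP px0) eqxx.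
have Dp : p = p %/ q * q by rewrite divpK.
have pq_mon : p %/ q \is monic.
  by move: p_mon; rewrite {1}Dp monicMr.
have q_neq0 : q != 0 by rewrite monic_neq0.
have [||k Dk] := IHs _ pq_mon.
- apply: leq_trans size_p; rewrite size_divp // ltn_subrL.
  case: q_irr => q_size _.
  by rewrite -subn1 subn_gt0 q_size /= size_poly_gt0 monic_neq0.
- move=> y py0; apply: rpq; rewrite Dp rmorphM rootM.
  by rewrite py0.
by exists k.+1; rewrite Dp Dk exprSr.
Qed.

(** Every other term of the convolution has an index beyond the size bound of [p] or of [q]. *)
Lemma coefM_subtop (F : comNzRingType) (p q : {poly F}) a b :
  (size p <= a.+2)%N -> (size q <= b.+2)%N ->
  (p * q)`_(a + b).+1 = p`_a * q`_b.+1 + p`_a.+1 * q`_b.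
Proof.
move=> sp sq; rewrite coefM.
have la : (a < (a + b).+2)%N by rewrite ltnS leqW // leq_addr.
have la1 : (a.+1 < (a + b).+2)%N by rewrite ltnS ltnS leq_addr.
rewrite (bigD1 (Ordinal la)) //= (bigD1 (Ordinal la1)) /=; last first.
  by rewrite -val_eqE /= eqn_leq ltnn.
rewrite big1 ?addr0 => [|[j lj] /=]; last first.
  rewrite -!val_eqE /= => /andP[ja ja1].
  have [jsmall|jbig] := ltnP j a.
    by rewrite [X in _ * X]nth_default ?mulr0 //; apply: leq_trans sq _; lia.
  by rewrite nth_default ?mul0r //; apply: leq_trans sp _; lia.
by congr (_ * q`__ + _ * q`__); lia.
Qed.

(** The subleading coefficient of a monic polynomial is minus the sum of its roots, which a power
    multiplies by the exponent. *)
Lemma coefX_subtop (F : idomainType) (q : {poly F}) D k :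
  q \is monic -> size q = D.+2 ->
  (q ^+ k.+1)`_(k * D.+1 + D) = k.+1%:R * q`_D.
Proof.
move=> q_mon size_q; elim: k => [|k IHk]; first by rewrite mul1r.
have size_qk : size (q ^+ k.+1) = (k * D.+1 + D).+2.
  rewrite -[LHS]prednK ?size_poly_gt0 ?monic_neq0 ?monic_exp //.
  by rewrite size_exp size_q /=; lia.
rewrite exprSr; have -> : (k.+1 * D.+1 + D = (k * D.+1 + D + D).+1)%N by lia.
rewrite coefM_subtop ?size_qk ?size_q // IHk.
have -> : q`_D.+1 = 1 by move/monicP: q_mon; rewrite lead_coefE size_q.
have -> : (q ^+ k.+1)`_(k * D.+1 + D).+1 = 1.
  by move/monicP: (monic_exp k.+1 q_mon); rewrite lead_coefE size_qk.
by rewrite mulr1 mul1r -[in RHS]natr1 mulrDl mul1r.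
Qed.

(* The characteristic polynomial of [N] is a power of [q]. *)
Lemma mxtrace_irreducible n (N : 'M[rat]_n.+1) (q : {poly rat}) D :
  q \is monic -> irreducible_poly q -> size q = D.+2 -> horner_mx N q = 0 ->
  D.+1%:R * \tr N = - (n.+1%:R * q`_D).
Proof.
move=> q_mon q_irr size_q qN.
have [||k Dk] := @monic_power_irreducible (char_poly N) q _ q_mon q_irr.
- exact: char_poly_monic.
(* The roots of the characteristic polynomial are those of the minimal polynomial, which divides
   [q]. *)
- move=> x; rewrite map_char_poly -root_mxminpoly mxminpoly_map => rx.
  have /dvdpP[u ->] := mxminpoly_min qN.
  by rewrite rmorphM rootM rx orbT.
have := size_char_poly N; rewrite Dk => /(congr1 predn); rewrite size_exp size_q.
case: k Dk => [|k] Dk; first by rewrite muln0.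
rewrite /= => Dn.
have Dn' : n = (k * D.+1 + D)%N by lia.
have := char_poly_trace N isT; rewrite Dk [n.+1.-1]Dn' coefX_subtop // => trE.
have -> : \tr N = - (k.+1%:R * q`_D) by rewrite trE opprK.
by rewrite -Dn natrM mulrN mulrA.
Qed.

Lemma horner_mx_comp (F : comNzRingType) n (M : 'M[F]_n.+1) (p u : {poly F}) :
  horner_mx M (p \Po u) = horner_mx (horner_mx M u) p.
Proof.
elim/poly_ind: p => [|p c IHp]; first by rewrite comp_poly0 !rmorph0.
by rewrite comp_polyD comp_polyM comp_polyX comp_polyC !rmorphD !rmorphM /=
  IHp horner_mx_X !horner_mx_C.
Qed.

Section Trace.
Variables (K : numFieldType).
Notation pQK := (map_poly (ratr : rat -> K)).

(** Iterates the primitive element theorem in characteristic 0, so that all the numbers of a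
    relation become polynomials in a single [z]. *)
Lemma primitive_element_seq (s : seq K) :
  (forall x, x \in s -> algebraicOver (ratr : rat -> K) x) ->
  exists2 z, algebraicOver (ratr : rat -> K) z &
    forall x, x \in s -> exists p, (pQK p).[z] = x.
Proof.
elim: s => [|x s IHs] alg_s; first by exists 0 => //; exact: algebraic0.
have [|y [py py0 pyy] gen_y] := IHs.
  by move=> u us; apply: alg_s; rewrite inE us orbT.
have alg_x : algebraicOver (ratr : rat -> K) x by apply: alg_s; rewrite mem_head.
have [px px0 pxx] := alg_x.
have [n [[px' Dx] [py' Dy]]] := pchar0_PET px0 pxx py0 pyy (pchar_num _).
exists (y *+ n - x).
  apply: algebraic_sub => //; rewrite -mulr_natr; apply: algebraic_mul.
    by exists py.
  by rewrite -(ratr_nat K n); apply: algebraic_id.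
move=> u; rewrite inE => /orP[/eqP->|us]; first by exists px'.
have [pu Du] := gen_y u us; exists (pu \Po py').
by rewrite map_comp_poly horner_comp Dy.
Qed.

(** Take a nonzero annihilator of least size, made monic: the remainder of any other annihilator
    modulo it is a smaller one, hence zero. *)
Lemma minimal_polynomial (z : K) : algebraicOver (ratr : rat -> K) z ->
  exists r : {poly rat}, [/\ r \is monic, (1 < size r)%N, root (pQK r) z &
    forall p, root (pQK p) z -> r %| p].
Proof.
move=> [p0 p0_neq0 p0z].
have ex_n : exists n, `[< exists p, [/\ p != 0, root (pQK p) z & size p = n] >].
  by exists (size p0); apply/asboolP; exists p0.
case: (ex_minnP ex_n) => n /asboolP[p [p_neq0 pz size_p]] min_n.
pose c := (lead_coef p)^-1.
have c_neq0 : c != 0 by rewrite invr_eq0 lead_coef_eq0.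
have rz : root (pQK (c *: p)) z by rewrite map_polyZ rootE hornerZ (rootP pz) mulr0.
exists (c *: p); split => //.
- by rewrite monicE lead_coefZ mulVf // lead_coef_eq0.
- rewrite size_scale // ltnNge; apply/negP => /size1_polyC Dp.
  move: pz p_neq0; rewrite Dp map_polyC rootC polyC_eq0 fmorph_eq0.
  by move=> /eqP->; rewrite eqxx.
- move=> q qz; rewrite dvdpZl // /dvdp; apply/eqP/eqP; apply: contraT => mod_neq0.
  have := ltn_modp q p; rewrite p_neq0 => /idP.
  rewrite ltnNge size_p min_n //; apply/asboolP; exists (q %% p); split => //.
  have: root (pQK (q %/ p * p + q %% p)) z by rewrite -divp_eq.
  by rewrite rmorphD rmorphM rootE hornerD hornerM /= (rootP pz) mulr0 add0r.
Qed.

(** When [r] is the minimal polynomial of a primitive element, polynomials in [M] model the field it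
    generates, and the matrix trace is the field trace. *)
Lemma companion_matrix_exists (r : {poly rat}) : r \is monic -> (1 < size r)%N ->
  exists n (M : 'M[rat]_n.+1), char_poly M = r.
Proof.
move=> r_mon r_size; have := companionmxK r_mon.
have : (0 < (size r).-1)%N by rewrite -subn1 subn_gt0.
by move: (companionmx r); case: (size r).-1 => // n M _ DM; exists n, M.
Qed.

(* Averages the relation over the conjugates of the [theta j]: each of them
   has the same normalised trace [- p`_D / D.+1]. *)
Lemma trace_relation (p : {poly rat}) D d (theta : 'I_d -> K) (l : 'I_d -> int) (c : int) :
  p \is monic -> irreducible_poly p -> size p = D.+2 ->
  (forall j, root (pQK p) (theta j)) ->
  \sum_j (l j)%:~R * theta j = c%:~R ->
  D.+1%:R * c%:~R = - ((\sum_j l j)%:~R * p`_D) :> rat.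
Proof.
move=> p_mon p_irr size_p p_theta rel.
have [|z alg_z gen_z] := @primitive_element_seq (codom theta).
  by move=> _ /codomP[j ->]; exists p => //; apply: monic_neq0.
have /choice[u Du] : forall j, exists u, (pQK u).[z] = theta j.
  by move=> j; apply: gen_z; apply: codom_f.
have [r [r_mon r_size rz min_r]] := minimal_polynomial alg_z.
have [n [M DM]] := companion_matrix_exists r_mon r_size.
(* By Cayley-Hamilton, every rational polynomial relation satisfied by [z] holds for [M]. *)
have vanish q : root (pQK q) z -> horner_mx M q = 0.
  move=> /min_r /dvdpP[v ->].
  by rewrite rmorphM /= -DM Cayley_Hamilton mulr0.
have trN j : D.+1%:R * \tr (horner_mx M (u j)) = - (n.+1%:R * p`_D).
  apply: mxtrace_irreducible => //; rewrite -horner_mx_comp; apply: vanish.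
  by rewrite map_comp_poly root_comp Du.
have relz : root (pQK (\sum_j u j *~ l j - c%:~R)) z.
  rewrite rmorphB rmorph_sum /= rmorph_int rootE hornerD hornerN.
  rewrite horner_sum hornerMz hornerE /= -rel subr_eq0; apply/eqP/eq_bigr => j _.
  by rewrite rmorphMz /= hornerMz Du mulrzl.
(* Take traces in the matrix form of [rel]; the dimension [n.+1] cancels at the end. *)
have := congr1 (fun X => D.+1%:R * \tr X) (vanish _ relz).
rewrite rmorphB rmorph_sum /= rmorph_int !raddfB /= raddf_sum raddfMz /= mxtrace1.
rewrite mxtrace0 mulr0 mulrBr mulr_sumr.
have hN j : D.+1%:R * \tr (horner_mx M (u j *~ l j)) = (l j)%:~R * - (n.+1%:R * p`_D).
  rewrite -(trN j) mulrCA mulrzl -raddfMz; congr (_ * \tr _).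
  exact: (rmorphMz (horner_mx M)).
rewrite (eq_bigr _ (fun j _ => hN j)).
rewrite -mulr_suml -rmorph_sum /= => /eqP; rewrite subr_eq0 => /eqP eqn.
have n_neq0 : n.+1%:R != 0 :> rat by rewrite pnatr_eq0.
by apply: (mulIf n_neq0); rewrite -mulrA [c%:~R * _]mulrzl -eqn; ring.
Qed.
End Trace.

(** * A parity version of Kronecker's theorem *)

Section Expi.
Variable R : realType.
Implicit Types x y : R.

Definition expi x : R[i] := Complex (cos x) (sin x).

Lemma expi0 : expi 0 = 1.
Proof. by rewrite /expi cos0 sin0. Qed.

Lemma expiD x y : expi (x + y) = expi x * expi y.
Proof. by rewrite /expi cosD sinD; apply/eqP; rewrite eq_complex /= !eqxx /= addrC. Qed.

Lemma expiMn x n : expi (x *+ n) = expi x ^+ n.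
Proof. by elim: n => [|n IHn]; rewrite ?expi0 // mulrS exprS expiD IHn. Qed.

Lemma expi_conj x : expi x * expi (- x) = 1.
Proof. by rewrite -expiD subrr expi0. Qed.

(** Real part of the binomial expansion of [(expi y + expi (- y)) ^+ n]; the coefficients are
    visibly nonnegative. *)
Lemma cosX (n : nat) y :
  (2 * cos y) ^+ n = \sum_(k < n.+1) 'C(n, k)%:R * cos ((n%:R - 2 * k%:R) * y).
Proof.
have Dy : (2 * cos y)%:C%C = expi y + expi (- y).
  apply/eqP; rewrite eq_complex /= cosN sinN subrr eqxx andbT.
  by rewrite mulr_natl mulr2n.
have : ((2 * cos y) ^+ n)%:C%C = (expi y + expi (- y)) ^+ n.
  by rewrite rmorphXn /= Dy.
rewrite exprDn => /(congr1 (@complex.Re R)) /= ->.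
rewrite raddf_sum /=; apply: eq_bigr => -[k lkn] _ /=.
rewrite -!expiMn -expiD -mulr_natl -[_ * expi _]/(_%:R * expi _).
have -> : y *+ (n - k) + (- y) *+ k = (n%:R - 2 * k%:R) * y.
  by rewrite mulNrn -[_ *+ (n - k)]mulr_natl natrB // -mulr_natl; ring.
by rewrite -(rmorph_nat (real_complex R)) /= mul0r subr0.
Qed.

End Expi.

(** With [s = 1 - rho] one has [(1 + s) * rho <= 1], so it suffices that [(1 + s) ^+ p] exceed
    [(2 * p) ^+ d]. For [p = r * d.+1], Bernoulli bounds the former below by [(r * s) ^+ d.+1]. *)
Lemma poly_lt_exp (R : realType) (rho : R) d : 0 <= rho < 1 ->
  exists2 p, (0 < p)%N & (2 * p%:R) ^+ d * rho ^+ p < 1.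
Proof.
move=> /andP[rho0 rho1]; pose s := 1 - rho; have s0 : 0 < s by rewrite subr_gt0.
have [->|rho_neq0] := eqVneq rho 0; first by exists 1; rewrite ?mulr0.
(* Large enough that the one extra factor [r] absorbs the constants independent of [r]. *)
pose r := (Num.bound ((2 * d.+1%:R) ^+ d / s ^+ d.+1)).+1.
have rlarge : (2 * d.+1%:R) ^+ d < r%:R * s ^+ d.+1.
  rewrite -ltr_pdivrMr ?exprn_gt0 //; apply: le_lt_trans (ler_norm _) _.
  by apply: (lt_trans (unstable.ltr_norm_bound _)); rewrite ltr_nat.
have r0 : 0 < r%:R :> R by rewrite ltr0n.
have bernoulli k : 1 + k%:R * s <= (1 + s) ^+ k.
  elim: k => [|k IHk]; first by rewrite mul0r addr0.
  rewrite exprSr; apply: le_trans (ler_wpM2r _ IHk); last by lra.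
  have := mulr_ge0 (ler0n R k) (mulr_ge0 (ltW s0) (ltW s0)).
  by rewrite -natr1; lra.
exists (r * d.+1)%N => //.
have large : (2 * (r * d.+1)%:R) ^+ d < (1 + s) ^+ (r * d.+1) :> R.
  have -> : (2 * (r * d.+1)%:R) ^+ d = r%:R ^+ d * (2 * d.+1%:R) ^+ d :> R.
    by rewrite -exprMn natrM; congr (_ ^+ d); ring.
  apply: (@lt_le_trans _ _ (r%:R ^+ d * (r%:R * s ^+ d.+1))).
    by rewrite ltr_pM2l ?exprn_gt0.
  rewrite mulrA -exprSr -exprMn exprM.
  apply: lerXn2r; rewrite ?nnegrE.
  - by rewrite mulr_ge0 // ltW.
  - by apply: exprn_ge0; lra.
  - by apply: le_trans (bernoulli r); lra.
apply: (@lt_le_trans _ _ ((1 + s) ^+ (r * d.+1) * rho ^+ (r * d.+1))).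
  by rewrite ltr_pM2r // exprn_gt0 // lt_def rho_neq0.
by rewrite -exprMn exprn_ile1 // /s; nra.
Qed.

(** * Cosine sums with nonnegative coefficients and frequencies in a group [L] *)

Section CosineSums.
Variable R : realType.
Variable L : R -> Prop.
Hypothesis L0 : L 0.
Hypothesis LB : forall a b, L a -> L b -> L (a - b).

Let LD a b : L a -> L b -> L (a + b).
Proof. by move=> La Lb; rewrite -[b]opprK -[- b]sub0r; do !apply: LB. Qed.

Let LMn a n : L a -> L (n%:R * a).
Proof.
move=> La; elim: n => [|n IHn]; first by rewrite mul0r.
by rewrite -natr1 mulrDl mul1r; apply: LD.
Qed.

(** The sign condition on the coefficients is what lets lower bounds on averages of single cosines
    add up. *)
Inductive cosine_sum : (R -> R) -> Prop :=
| cosine_sum0 f : (forall x, f x = 0) -> cosine_sum f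
| cosine_sumS c a g f : 0 <= c -> L a -> cosine_sum g ->
    (forall x, f x = c * cos (a * x) + g x) -> cosine_sum f.

Lemma cosine_sumD f g : cosine_sum f -> cosine_sum g ->
  cosine_sum (fun x => f x + g x).
Proof.
move=> sf sg; elim: sf => {f} [f f0|c a f' f c0 La _ IHf Df].
  by have -> : (fun x => f x + g x) = g by apply/funext => x; rewrite f0 add0r.
by apply: (cosine_sumS c0 La IHf) => x; rewrite Df addrA.
Qed.

Lemma cosine_sumZ b f : 0 <= b -> cosine_sum f -> cosine_sum (fun x => b * f x).
Proof.
move=> b0; elim=> {f} [f f0|c a f' f c0 La _ IHf Df].
  by apply: cosine_sum0 => x; rewrite f0 mulr0.
by apply: (cosine_sumS (mulr_ge0 b0 c0) La IHf) => x; rewrite Df mulrDr mulrA.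
Qed.

Lemma cosine_sum_cos a : L a -> cosine_sum (fun x => cos (a * x)).
Proof.
move=> La; apply: (@cosine_sumS 1 a (fun=> 0)) => //; first exact: cosine_sum0.
by move=> x; rewrite mul1r addr0.
Qed.

(** Product-to-sum formula: the frequencies [a + b] and [a - b] stay in [L], and the coefficients
    [c / 2] stay nonnegative. *)
Lemma cosine_sum_cosM a f : L a -> cosine_sum f ->
  cosine_sum (fun x => cos (a * x) * f x).
Proof.
move=> La; elim=> {f} [f f0|c b f' f c0 Lb _ IHf Df].
  by apply: cosine_sum0 => x; rewrite f0 mulr0.
have -> : (fun x => cos (a * x) * f x) = (fun x => c / 2 * cos ((a + b) * x)
    + (c / 2 * cos ((a - b) * x) + cos (a * x) * f' x)).
  apply/funext => x; rewrite Df mulrDl mulrBl cosD cosB; lra.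
have c2 : 0 <= c / 2 by rewrite divr_ge0.
apply: cosine_sumD; first by apply/cosine_sumZ/cosine_sum_cos/LD.
by apply: cosine_sumD => //; apply/cosine_sumZ/cosine_sum_cos/LB.
Qed.

Lemma cosine_sumM f g : cosine_sum f -> cosine_sum g ->
  cosine_sum (fun x => f x * g x).
Proof.
move=> sf sg; elim: sf => {f} [f f0|c a f' f c0 La _ IHf Df].
  by apply: cosine_sum0 => x; rewrite f0 mul0r.
have -> : (fun x => f x * g x) = (fun x => c * (cos (a * x) * g x) + f' x * g x).
  by apply/funext => x; rewrite Df mulrDl mulrA.
by apply: cosine_sumD => //; apply: cosine_sumZ => //; apply: cosine_sum_cosM.
Qed.

Lemma cosine_sum_sum I (r : seq I) (P : pred I) (F : I -> R -> R) :
  (forall i, P i -> cosine_sum (F i)) -> cosine_sum (fun x => \sum_(i <- r | P i) F i x).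
Proof.
move=> sF; elim: r => [|i r IHr]; first by apply: cosine_sum0 => x; rewrite big_nil.
case Pi : (P i).
  have -> : (fun x => \sum_(j <- i :: r | P j) F j x)
      = (fun x => F i x + \sum_(j <- r | P j) F j x).
    by apply/funext => x; rewrite big_cons Pi.
  by apply: cosine_sumD => //; apply: sF.
have -> // : (fun x => \sum_(j <- i :: r | P j) F j x)
    = (fun x => \sum_(j <- r | P j) F j x).
by apply/funext => x; rewrite big_cons Pi.
Qed.

(** The constant Fourier coefficient of [((1 + cos x) / 2) ^+ p]. *)
Definition kernel_weight p : R := 'C(2 * p, p)%:R / 4 ^+ p.

(** The kernel is [cos (t * x / 2) ^+ (2 * p)]. In its binomial expansion the index [k] has
    frequency [(p - k) * t], so the middle index [k = p] gives the constant. *)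
Lemma kernel_expansion t p : L t ->
  exists2 h, cosine_sum h &
    forall x, ((1 + cos (t * x)) / 2) ^+ p = kernel_weight p + h x.
Proof.
move=> Lt.
have lp : (p < (2 * p).+1)%N by rewrite ltnS mul2n -addnn leq_addr.
exists (fun x => (4 ^+ p)^-1 *
  \sum_(k < (2 * p).+1 | k != Ordinal lp) 'C(2 * p, k)%:R * cos ((p%:R * t - k%:R * t) * x)).
  apply: cosine_sumZ; first by rewrite invr_ge0 exprn_ge0.
  apply: cosine_sum_sum => k _; apply: cosine_sumZ => //.
  by apply: cosine_sum_cos; apply: LB; apply: LMn.
move=> x; have := cosX (2 * p) (t * x / 2).
rewrite exprM (bigD1 (Ordinal lp)) //= natrM subrr mul0r cos0 mulr1.
have -> : (2 * cos (t * x / 2)) ^+ 2 = 4 * ((1 + cos (t * x)) / 2).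
  have -> : cos (t * x) = cos (t * x / 2 *+ 2) by congr cos; field.
  by rewrite cos_mulr2n; field.
rewrite exprMn => D; have p4 : 4 ^+ p != 0 :> R by rewrite expf_neq0 // pnatr_eq0.
apply: (mulfI p4); rewrite D /kernel_weight mulrDr mulrCA mulfV // mulr1 mulrA mulfV //.
rewrite mul1r; congr (_ + _); apply: eq_bigr => k _; congr (_ * cos _); by field.
Qed.

(** Consecutive weights have ratio [(2 p + 1) / (2 p + 2)], and [1 / (2 p)] times this ratio is at
    least [1 / (2 p + 2)]. *)
Lemma kernel_weight_ge p : (0 < p)%N -> (2 * p%:R)^-1 <= kernel_weight p.
Proof.
rewrite /kernel_weight; elim: p => // -[|p] IHp _; first by rewrite bin1; lra.
have /(congr1 (fun n => n%:R : R)) :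
    ('C(2 * p.+2, p.+2) * p.+2 = 'C(2 * p.+1, p.+1) * (2 * (2 * p.+1).+1))%N.
  have := mul_bin_diag (2 * p.+2) p.+1; have := mul_bin_down (2 * p.+1).+1 p.+1.
  have -> : (2 * p.+2 = (2 * p.+1).+2)%N by lia.
  rewrite /= => H1 H2; move: H1; have -> : ((2 * p.+1).+1 - p.+1 = p.+2)%N by lia.
  by move=> H1; rewrite mulnC -H2; nia.
rewrite !natrM => H.
have q0 : 0 < p.+1%:R :> R by rewrite ltr0n.
have {}IHp := IHp isT.
have E : 'C(2 * p.+2, p.+2)%:R / 4 ^+ p.+2 =
    'C(2 * p.+1, p.+1)%:R / 4 ^+ p.+1 * ((2 * p.+1).+1%:R / (2 * p.+2%:R)) :> R.
  have p0 : p.+2%:R != 0 :> R by rewrite pnatr_eq0.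
  apply: (mulIf p0); rewrite mulrAC H exprSr.
  have q4 : 4 ^+ p.+1 != 0 :> R by rewrite expf_neq0 // pnatr_eq0.
  move: (4 ^+ p.+1) (p.+2%:R) ((2 * p.+1).+1%:R) q4 p0 => u v x u0 v0.
  by field; rewrite u0 v0.
rewrite E; apply: le_trans (ler_wpM2r _ IHp); last by rewrite divr_ge0 ?mulr_ge0.
rewrite -[(2 * p.+1).+1%:R]natr1 natrM -[p.+2%:R]natr1.
move: (p.+1%:R) q0 => q q0.
rewrite [X in _ <= X](_ : _ = (1 + (2 * q)^-1) * (2 * (q + 1))^-1).
  rewrite -[X in X <= _]mul1r; apply: ler_wpM2r; first by rewrite invr_ge0; lra.
  by rewrite lerDl invr_ge0; lra.
by field; rewrite !gt_eqF //; lra.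
Qed.

(** The constants multiply, and all cross terms go into [h]. A cross term may have frequency 0
    again, which is harmless since its coefficient is nonnegative. *)
Lemma kernel_product_expansion (s : seq R) p : (forall t, t \in s -> L t) ->
  exists2 h, cosine_sum h &
    forall x, \prod_(t <- s) ((1 + cos (t * x)) / 2) ^+ p
      = kernel_weight p ^+ size s + h x.
Proof.
elim: s => [|t s IHs] Ls.
  by exists (fun=> 0) => [|x]; [exact: cosine_sum0 | rewrite big_nil addr0].
have [|h sh Dh] := IHs; first by move=> u us; apply: Ls; rewrite inE us orbT.
have [|g sg Dg] := @kernel_expansion t p; first by apply: Ls; rewrite mem_head.
set w := kernel_weight p in Dh Dg *.
have w0 : 0 <= w by rewrite /w /kernel_weight divr_ge0 // exprn_ge0.
exists (fun x => w * h x + (w ^+ size s * g x + g x * h x)).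
  apply: cosine_sumD; first exact: cosine_sumZ.
  apply: cosine_sumD; last exact: cosine_sumM.
  by apply: cosine_sumZ => //; apply: exprn_ge0.
by move=> x; rewrite big_cons Dh Dg /= exprS; ring.
Qed.

Hypothesis L_even : forall n : int, L n%:~R -> exists k : int, n = k *+ 2.

Let oddpt (k : nat) : R := pi * (2 * k + 1)%:R.

Lemma sin_intpi (n : int) : sin (pi * n%:~R) = 0 :> R.
Proof.
have H k : sin (pi * k%:R) = 0 :> R.
  by rewrite mulr_natr -[pi *+ k]add0r (alternatingn (@sinDpi R)) sin0 mulr0.
case: n => n; first exact: H.
by rewrite NegzE mulrNz mulrN sinN H oppr0.
Qed.

Lemma sinpi_neq0 (a : R) : (forall n : int, a != n%:~R) -> sin (pi * a) != 0.
Proof.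
move=> aZ; pose r := a - (Num.floor a)%:~R.
have /andP[ra ra1] := floor_itv a.
have r01 : 0 < r < 1.
  rewrite /r subr_gt0 lt_neqAle eq_sym aZ ra /=.
  by move: ra1; rewrite rmorphD /=; lra.
have pi0 := pi_gt0 R.
have : 0 < sin (pi * r).
  apply: sin_gt0_pi; case/andP: r01 => r0 r1.
  by rewrite mulr_gt0 //= -[X in _ < X]mulr1 ltr_pM2l.
rewrite /r mulrBr sinB sin_intpi mulr0 subr0 => H.
by apply: contraTN H => /eqP->; rewrite mul0r ltxx.
Qed.

(** This is where parity enters: an integer [a] in [L] is even, so every term is 1, whereas an odd
    one would give -1 throughout. For any other [a], multiplying by [2 * sin (pi * a)] makes the sum
    telescope. *)
Lemma cosine_average_ge a : L a ->
  exists C, forall N, - C <= \sum_(k < N) cos (a * oddpt k).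
Proof.
move=> La; have [[n Dn]|aZ] := pselect (exists n : int, a = n%:~R).
  exists 0 => N; rewrite oppr0 sumr_ge0 // => k _.
  have [j Dj] : exists j : int, n = j *+ 2 by apply: L_even; rewrite -Dn.
  have -> : a * oddpt k = (pi * (j * (2 * k + 1)%N%:Z)%:~R) *+ 2.
    by rewrite Dn Dj /oddpt rmorphMn rmorphM /= pmulrn; ring.
  by rewrite cos_mulr2n cos2sin2 sin_intpi expr0n subr0 mulr2n addrK.
have sa : sin (pi * a) != 0.
  by apply: sinpi_neq0 => n; apply/eqP => Dn; apply: aZ; exists n.
exists (`|sin (pi * a)|^-1) => N.
have E : 2 * sin (pi * a) * \sum_(k < N) cos (a * oddpt k) = sin (2 * N%:R * (pi * a)).
  rewrite mulr_sumr; transitivity (\sum_(0 <= k < N)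
      (sin (2 * k.+1%:R * (pi * a)) - sin (2 * k%:R * (pi * a)))).
    rewrite big_mkord; apply: eq_bigr => k _; rewrite /oddpt.
    have -> : a * (pi * (2 * k + 1)%:R) = (2 * k%:R + 1) * (pi * a).
      by rewrite natrD natrM; ring.
    have -> : 2 * k.+1%:R * (pi * a) = (2 * k%:R + 1) * (pi * a) + pi * a.
      by rewrite -natr1; ring.
    have -> : 2 * k%:R * (pi * a) = (2 * k%:R + 1) * (pi * a) - pi * a by ring.
    by rewrite sinD sinB; ring.
  by rewrite telescope_sumr // mulr0 mul0r sin0 subr0.
have s0 : 0 < `|sin (pi * a)| by rewrite normr_gt0.
suff : `|\sum_(k < N) cos (a * oddpt k)| <= `|sin (pi * a)|^-1.
  by rewrite ler_norml => /andP[].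
rewrite -[X in _ <= X]mul1r ler_pdivlMr // -normrM mulrC.
have := sin_max (2 * N%:R * (pi * a)); rewrite -E -mulrA normrM normr_nat.
by have := normr_ge0 (sin (pi * a) * \sum_(k < N) cos (a * oddpt k)); lra.
Qed.

Lemma cosine_sum_average_ge f : cosine_sum f ->
  exists C, forall N, - C <= \sum_(k < N) f (oddpt k).
Proof.
elim=> {f} [f f0|c a f' f c0 La _ [C HC] Df].
  by exists 0 => N; rewrite big1 ?oppr0.
have [B HB] := cosine_average_ge La; exists (c * B + C) => N.
under eq_bigr => k _ do rewrite Df.
rewrite big_split /= -mulr_sumr opprD -mulrN; apply: lerD; last exact: HC.
by apply: ler_wpM2l => //; exact: HB.
Qed.

(* The kernel [prod_t ((1 + cos (t x)) / 2) ^ p] has nonnegative Fourier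
   coefficients and a constant term polynomially small in [p], so its mean over
   the points [oddpt k] is not exponentially small, whereas the kernel would be
   if every point were far from [0]. *)
Lemma odd_simultaneous_approximation (s : seq R) (e : R) : (forall t, t \in s -> L t) ->
  0 < e -> exists k : nat, forall t, t \in s -> 1 - e < cos (t * oddpt k).
Proof.
move=> Ls e0; apply: contrapT => /forallNP far.
have {}far k : exists2 t, t \in s & cos (t * oddpt k) <= 1 - e.
  have /existsNP[t /not_implyP[ts /negP]] := far k.
  by rewrite -leNgt => tk; exists t.
(* A cosine at most [1 - e] makes its factor at most [1 - e / 2]; the maximum with 0 covers
   [e > 2]. *)
pose rho : R := Num.max 0 (1 - e / 2).
have rho01 : 0 <= rho < 1 by rewrite le_max lexx /= gt_max ltr01 /=; lra.
have [p p0 small] := poly_lt_exp (size s) rho01.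
have [h sh Dh] := kernel_product_expansion p Ls.
have [C HC] := cosine_sum_average_ge sh.
have factor01 (t x : R) : 0 <= (1 + cos (t * x)) / 2 <= 1.
  by have := cos_geN1 (t * x); have := cos_le1 (t * x); lra.
have le_rho k : \prod_(t <- s) ((1 + cos (t * oddpt k)) / 2) ^+ p <= rho ^+ p.
  have [t ts tk] := far k; rewrite (big_rem t) //= -[X in _ <= X]mulr1.
  have /andP[f0 f1] := factor01 t (oddpt k).
  apply: ler_pM.
  - exact: exprn_ge0.
  - by apply: prodr_ge0 => u _; apply: exprn_ge0; case/andP: (factor01 u (oddpt k)).
  - apply: lerXn2r; rewrite ?nnegrE //; first by case/andP: rho01.
    by rewrite le_max; apply/orP; right; lra.
  - elim: (rem t s) => [|u r IHr]; first by rewrite big_nil.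
    rewrite big_cons -[X in _ <= X]mulr1; have /andP[g0 g1] := factor01 u (oddpt k).
    apply: ler_pM => //; last exact: exprn_ile1.
      exact: exprn_ge0.
    by apply: prodr_ge0 => v _; apply: exprn_ge0; case/andP: (factor01 v (oddpt k)).
set w := kernel_weight p ^+ size s in Dh.
have w_gt : rho ^+ p < w.
  have p2 : 0 < 2 * p%:R :> R by rewrite mulr_gt0 // ltr0n.
  apply: (@lt_le_trans _ _ ((2 * p%:R)^-1 ^+ size s)).
    by rewrite exprVn -[X in _ < X]mul1r ltr_pdivlMr ?exprn_gt0 // mulrC.
  apply: lerXn2r; rewrite ?nnegrE; last exact: kernel_weight_ge.
    by rewrite invr_ge0 ltW.
  by rewrite divr_ge0 // exprn_ge0.
(* Summed over [N] points, [h] contributes at least [- C], so the positive gap [w - rho ^+ p] would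
   bound every [N]. *)
have bound N : N%:R * (w - rho ^+ p) <= C.
  have : \sum_(k < N) (w + h (oddpt k)) <= \sum_(k < N) rho ^+ p.
    by apply: ler_sum => k _; rewrite -Dh.
  rewrite big_split /= !sumr_const card_ord -[w *+ N]mulr_natl -[rho ^+ p *+ N]mulr_natl mulrBr.
  by have := HC N; lra.
have := bound (Num.bound (C / (w - rho ^+ p))).
apply/negP; rewrite -ltNge -ltr_pdivrMr ?subr_gt0 //.
apply: (le_lt_trans (ler_norm _)); exact: unstable.ltr_norm_bound.
Qed.

End CosineSums.

(** * The matrix exponential *)

Section ComplexLimits.
Local Open Scope classical_set_scope.
Variable R : realType.
Implicit Types (z w : nat -> R[i]) (a b : R[i]).

Lemma ccvg_unique z a b : ccvg z a -> ccvg z b -> a = b.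
Proof.
move=> [zar zai] [zbr zbi]; apply/eqP; rewrite eq_complex.
by rewrite (norm_cvg_unique zar zbr) (norm_cvg_unique zai zbi) !eqxx.
Qed.

Lemma climitE z a : ccvg z a -> climit z = a.
Proof.
move=> [zr zi]; case: a zr zi => x y zr zi; rewrite /climit.
by rewrite (cvg_lim _ zr) ?(cvg_lim _ zi).
Qed.

Lemma ccvg_cst a : ccvg (fun=> a) a.
Proof. by split; apply: cvg_cst. Qed.

Lemma ccvgD z w a b : ccvg z a -> ccvg w b -> ccvg (fun k => z k + w k) (a + b).
Proof.
move=> [zr zi] [wr wi]; case: a b zr zi wr wi => [x y] [x' y'] zr zi wr wi.
split=> /=.
  rewrite [X in X @ _ --> _](_ : _ =
    (fun k => complex.Re (z k)) \+ (fun k => complex.Re (w k))).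
    exact: cvgD.
  by apply/funext => k /=; case: (z k) (w k) => ? ? [].
rewrite [X in X @ _ --> _](_ : _ =
  (fun k => complex.Im (z k)) \+ (fun k => complex.Im (w k))).
  exact: cvgD.
by apply/funext => k /=; case: (z k) (w k) => ? ? [].
Qed.

Lemma ccvgM z w a b : ccvg z a -> ccvg w b -> ccvg (fun k => z k * w k) (a * b).
Proof.
move=> [zr zi] [wr wi]; case: a b zr zi wr wi => [x y] [x' y'] zr zi wr wi.
split=> /=.
  rewrite [X in X @ _ --> _](_ : _ =
    (fun k => complex.Re (z k)) \* (fun k => complex.Re (w k))
    \- (fun k => complex.Im (z k)) \* (fun k => complex.Im (w k))).
    by apply: cvgB; apply: cvgM.
  by apply/funext => k /=; case: (z k) (w k) => ? ? [].
rewrite [X in X @ _ --> _](_ : _ =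
  (fun k => complex.Re (z k)) \* (fun k => complex.Im (w k))
  \+ (fun k => complex.Im (z k)) \* (fun k => complex.Re (w k))).
  by apply: cvgD; apply: cvgM.
by apply/funext => k /=; case: (z k) (w k) => ? ? [].
Qed.

Lemma ccvg_sum (I : eqType) (r : seq I) (z : I -> nat -> R[i]) (a : I -> R[i]) :
  (forall i, i \in r -> ccvg (z i) (a i)) -> ccvg (fun k => \sum_(i <- r) z i k) (\sum_(i <- r) a i).
Proof.
elim: r => [|i r IHr] za.
  rewrite big_nil [X in ccvg X _](_ : _ = fun=> 0); first exact: ccvg_cst.
  by apply/funext => k; rewrite big_nil.
rewrite big_cons [X in ccvg X _](_ : _ = fun k => z i k + \sum_(i <- r) z i k).
  apply: ccvgD; first by apply: za; rewrite mem_head.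
  by apply: IHr => j jr; apply: za; rewrite inE jr orbT.
by apply/funext => k; rewrite big_cons.
Qed.

Lemma ccvg_eq z w a : z =1 w -> ccvg w a -> ccvg z a.
Proof. by move=> /funext->. Qed.

(** Preferred to the modulus because it is real-valued, submultiplicative and visibly dominates both
    coordinates. *)
Definition cnorm1 a : R := `|complex.Re a| + `|complex.Im a|.

Lemma cnorm1_ge0 a : 0 <= cnorm1 a.
Proof. by rewrite addr_ge0. Qed.

Lemma cnorm1D a b : cnorm1 (a + b) <= cnorm1 a + cnorm1 b.
Proof.
case: a b => [x y] [x' y'] /=; rewrite /cnorm1 /= addrACA.
by apply: lerD; apply: ler_normD.
Qed.

Lemma cnorm1M a b : cnorm1 (a * b) <= cnorm1 a * cnorm1 b.
Proof.
case: a b => [x y] [x' y'] /=; rewrite /cnorm1 /=.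
apply: (@le_trans _ _ ((`|x| * `|x'| + `|y| * `|y'|) + (`|x| * `|y'| + `|y| * `|x'|))).
  by apply: lerD; rewrite -!normrM ?ler_normB // ler_normD.
lra.
Qed.

Lemma cnorm1X a k : cnorm1 (a ^+ k) <= cnorm1 a ^+ k.
Proof.
elim: k => [|k IHk]; first by rewrite !expr0 /cnorm1 /= normr1 normr0 addr0.
by rewrite !exprS (le_trans (cnorm1M _ _)) // ler_wpM2l // cnorm1_ge0.
Qed.

Lemma cnorm1_sum I (r : seq I) (F : I -> R[i]) :
  cnorm1 (\sum_(i <- r) F i) <= \sum_(i <- r) cnorm1 (F i).
Proof.
elim: r => [|i r IHr]; first by rewrite !big_nil /cnorm1 /= normr0 addr0.
by rewrite !big_cons (le_trans (cnorm1D _ _)) // lerD2l.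
Qed.

Lemma ccvg_series_dominated (u : nat -> R[i]) (b : R) :
  (forall k, cnorm1 (u k) <= b ^+ k / k`!%:R) -> 0 <= b ->
  exists a, ccvg (fun N => \sum_(k < N) u k) a.
Proof.
move=> ub b0.
have H (v : nat -> R) : (forall k, `|v k| <= cnorm1 (u k)) -> cvgn (series v).
  move=> vu; apply: normed_cvg; apply: (@series_le_cvg _ _ (exp_coeff b)) => //.
  - by move=> k; apply: normr_ge0.
  - by move=> k; apply: divr_ge0 => //; apply: exprn_ge0.
  - by move=> k; apply: le_trans (vu k) (ub k).
  - exact: is_cvg_series_exp_coeff.
have cr := H (fun k => complex.Re (u k)) (fun k => ltac:(by rewrite lerDl)).
have ci := H (fun k => complex.Im (u k)) (fun k => ltac:(by rewrite lerDr)).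
exists (Complex (limn (series (fun k => complex.Re (u k))))
                (limn (series (fun k => complex.Im (u k))))); split=> /=.
  rewrite [X in X @ _ --> _](_ : _ = series (fun k => complex.Re (u k))) //.
  by apply/funext => N; rewrite raddf_sum /series /= big_mkord.
rewrite [X in X @ _ --> _](_ : _ = series (fun k => complex.Im (u k))) //.
by apply/funext => N; rewrite raddf_sum /series /= big_mkord.
Qed.

Lemma expi_term (y : R) k :
  (Complex 0 y) ^+ k / k`!%:R = Complex (cos_coeff y k) (sin_coeff y k).
Proof.
have -> : (Complex 0 y) ^+ k = Complex ((~~ odd k)%:R * (-1) ^+ k./2 * y ^+ k)
    ((odd k)%:R * (-1) ^+ k.-1./2 * y ^+ k).
  elim: k => [|k IHk]; first by apply/eqP; rewrite eq_complex /=; apply/andP; split; apply/eqP; rewrite /=; ring.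
  rewrite exprS IHk; apply/eqP; rewrite eq_complex /=.
  case: k {IHk} => [|k] /=; first by rewrite !expr0 !expr1; apply/andP; split; apply/eqP; ring.
  rewrite !negbK !exprS; case: (odd k); rewrite /=; apply/andP; split; apply/eqP; ring.
rewrite -(rmorph_nat (real_complex R)) -fmorphV; apply/eqP; rewrite eq_complex /=.
by rewrite !mulr0 subr0 add0r /cos_coeff /sin_coeff /= !eqxx.
Qed.

Lemma ccvg_expi (y : R) :
  ccvg (fun N => \sum_(k < N) (Complex 0 y) ^+ k / k`!%:R) (expi y).
Proof.
have E : (fun N => \sum_(k < N) (Complex 0 y) ^+ k / k`!%:R) =
    fun N => Complex (series (cos_coeff y) N) (series (sin_coeff y) N).
  apply/funext => N; rewrite /series /= !big_mkord.
  elim: N => [|N IHN]; first by rewrite !big_ord0.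
  by rewrite !big_ord_recr /= IHN expi_term.
rewrite E; split => /=.
  by rewrite cos.unlock; apply: is_cvg_series_cos_coeff.
by rewrite sin.unlock; apply: is_cvg_series_sin_coeff.
Qed.

End ComplexLimits.

(** * Convergence of [U(t)] and its action on eigenvectors *)

Section MatrixExponential.
Variables (R : realType) (n : nat) (A : 'M[R[i]]_n).
Implicit Types (t : R) (x y : 'I_n).

(** Each factor [A] costs at most the sum of the norms of all its entries, which dominates every row
    sum. *)
Lemma cnorm1_mx_pow k x :
  \sum_y cnorm1 ((A ^+ k) x y) <= (\sum_x \sum_y cnorm1 (A x y)) ^+ k.
Proof.
set S := \sum_x _.
have S0 : 0 <= S by apply: sumr_ge0 => ? _; apply: sumr_ge0 => ? _; apply: cnorm1_ge0.
elim: k x => [|k IHk] x.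
  rewrite expr0 (bigD1 x) //= big1 ?addr0 => [|y yx]; rewrite mxE.
    by rewrite eqxx /cnorm1 /= normr1 normr0 addr0.
  by rewrite eq_sym (negPf yx) /cnorm1 /= normr0 addr0.
apply: (@le_trans _ _ (\sum_z cnorm1 (A x z) * \sum_y cnorm1 ((A ^+ k) z y))).
  under [X in _ <= X]eq_bigr => z _ do rewrite mulr_sumr.
  rewrite exchange_big /=; apply: ler_sum => y _.
  rewrite exprS -mulmxE mxE; apply: le_trans (cnorm1_sum _ _) _.
  by apply: ler_sum => z _; apply: cnorm1M.
apply: (@le_trans _ _ (\sum_z cnorm1 (A x z) * S ^+ k)).
  by apply: ler_sum => z _; rewrite ler_wpM2l ?cnorm1_ge0.
rewrite -mulr_suml exprS ler_wpM2r ?exprn_ge0 // /S [X in _ <= X](bigD1 x) //= lerDl.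
by apply: sumr_ge0 => ? _; apply: sumr_ge0 => ? _; apply: cnorm1_ge0.
Qed.

Lemma expSumE t N x y :
  expSum A t N x y = \sum_(k < N) (Complex 0 t) ^+ k / k`!%:R * (A ^+ k) x y.
Proof. by rewrite /expSum summxE; apply: eq_bigr => k _; rewrite mxE. Qed.

(** [Umat] is defined through the total function [lim]; comparison with the exponential series of
    [|t| * S] shows that it is a genuine limit. *)
Lemma expSum_cvg t x y : ccvg (fun N => expSum A t N x y) (Umat A t x y).
Proof.
set S := \sum_x \sum_y cnorm1 (A x y).
have S0 : 0 <= S by apply: sumr_ge0 => ? _; apply: sumr_ge0 => ? _; apply: cnorm1_ge0.
have [||a Ha] := @ccvg_series_dominated R
    (fun k => (Complex 0 t) ^+ k / k`!%:R * (A ^+ k) x y) (`|t| * S).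
- move=> k; apply: le_trans (cnorm1M _ _) _; rewrite exprMn mulrAC.
  apply: ler_pM; rewrite ?cnorm1_ge0 //.
    apply: le_trans (cnorm1M _ _) _; apply: ler_pM; rewrite ?cnorm1_ge0 //.
      by apply: le_trans (cnorm1X _ _) _; rewrite /cnorm1 /= normr0 add0r.
    rewrite -(rmorph_nat (real_complex R)) -fmorphV /cnorm1 /= normr0 addr0.
    by rewrite ger0_norm ?invr_ge0.
  apply: le_trans (cnorm1_mx_pow k x); rewrite [X in _ <= X](bigD1 y) //= lerDl.
  by apply: sumr_ge0 => ? _; apply: cnorm1_ge0.
- exact: mulr_ge0.
have {}Ha : ccvg (fun N => expSum A t N x y) a.
  by apply: ccvg_eq Ha => N; rewrite expSumE.
by rewrite /Umat mxE (climitE Ha).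
Qed.

(** The partial sums act on [v] by the partial sums of the scalar exponential; uniqueness of limits
    concludes entrywise. *)
Lemma Umat_eigencol t (theta : R) (v : 'cV[R[i]]_n) :
  A *m v = theta%:C%C *: v -> Umat A t *m v = expi (t * theta) *: v.
Proof.
move=> Av; apply/matrixP => x j; rewrite !mxE.
have Akv k : A ^+ k *m v = theta%:C%C ^+ k *: v.
  elim: k => [|k IHk]; first by rewrite expr0 mul1mx scale1r.
  by rewrite exprSr -mulmxE -mulmxA Av -scalemxAr IHk scalerA -exprS.
have E N : \sum_y expSum A t N x y * v y j =
    (\sum_(k < N) (Complex 0 (t * theta)) ^+ k / k`!%:R) * v x j.
  transitivity ((expSum A t N *m v) x j); first by rewrite mxE.
  rewrite /expSum mulmx_suml summxE mulr_suml; apply: eq_bigr => k _.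
  rewrite -scalemxAl Akv scalerA mxE; congr (_ * _).
  have -> : Complex 0 (t * theta) = Complex 0 t * theta%:C%C.
    by apply/eqP; rewrite eq_complex /= !mulr0 !mul0r subrr add0r !eqxx.
  by rewrite exprMn mulrAC.
apply: (@ccvg_unique _ (fun N => \sum_y expSum A t N x y * v y j)).
  by apply: ccvg_sum => y _; apply: ccvgM; [apply: expSum_cvg | apply: ccvg_cst].
apply: ccvg_eq E _.
by apply: ccvgM; [apply: ccvg_expi | apply: ccvg_cst].
Qed.

Lemma Umat_eigenrow t (theta : R) (w : 'rV[R[i]]_n) :
  w *m A = theta%:C%C *: w -> w *m Umat A t = expi (t * theta) *: w.
Proof.
move=> wA; apply/matrixP => i y; rewrite !mxE.
have wAk k : w *m A ^+ k = theta%:C%C ^+ k *: w.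
  elim: k => [|k IHk]; first by rewrite expr0 mulmx1 scale1r.
  by rewrite exprS -mulmxE mulmxA wA -scalemxAl IHk scalerA -exprS.
have E N : \sum_x w i x * expSum A t N x y =
    (\sum_(k < N) (Complex 0 (t * theta)) ^+ k / k`!%:R) * w i y.
  transitivity ((w *m expSum A t N) i y); first by rewrite mxE.
  rewrite /expSum mulmx_sumr summxE mulr_suml; apply: eq_bigr => k _.
  rewrite -scalemxAr wAk scalerA mxE; congr (_ * _).
  have -> : Complex 0 (t * theta) = Complex 0 t * theta%:C%C.
    by apply/eqP; rewrite eq_complex /= !mulr0 !mul0r subrr add0r !eqxx.
  by rewrite exprMn mulrAC.
apply: (@ccvg_unique _ (fun N => \sum_x w i x * expSum A t N x y)).
  by apply: ccvg_sum => x _; apply: ccvgM; [apply: ccvg_cst | apply: expSum_cvg].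
apply: ccvg_eq E _.
by apply: ccvgM; [apply: ccvg_expi | apply: ccvg_cst].
Qed.

End MatrixExponential.

(** * The adjacency matrix of T_{2,m} *)

(** By induction [A x - r x] is a sum of eigenvectors [v u] with [u != r]. Dividing each by [u - r]
    gives components of [x], and what remains of [x] is killed by [A - r]. *)
Lemma eigenvector_decomposition (F : fieldType) n (A : 'M[F]_n) (rs : seq F) (x : 'cV[F]_n) :
  uniq rs -> foldl (fun y r => A *m y - r *: y) x rs = 0 ->
  exists2 v : F -> 'cV[F]_n, (forall r, r \in rs -> A *m v r = r *: v r) &
    x = \sum_(r <- rs) v r.
Proof.
elim: rs x => [|r rs IHrs] x /=; first by move=> _ ->; exists (fun=> 0); rewrite ?big_nil.
move=> /andP[r_rs rs_uniq] /(IHrs _ rs_uniq)[v Av Dv].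
have rN u : u \in rs -> u - r != 0.
  by move=> urs; rewrite subr_eq0; apply: contraNneq r_rs => <-.
pose S := \sum_(u <- rs) (u - r)^-1 *: v u; pose x' := x - S.
have AS : A *m S = r *: S + \sum_(u <- rs) v u.
  rewrite mulmx_sumr scaler_sumr -big_split big_seq [RHS]big_seq /=.
  apply: eq_bigr => u urs; rewrite -scalemxAr (Av u urs) !scalerA.
  rewrite -[X in _ = _ + X]scale1r -scalerDl; congr (_ *: _).
  by rewrite -[X in _ = _ + X](mulVf (rN u urs)); ring.
have Ax' : A *m x' = r *: x'.
  rewrite mulmxBr AS -Dv; move: (A *m x) => y.
  by apply/matrixP => a b; rewrite !mxE; ring.
exists (fun u => if u == r then x' else (u - r)^-1 *: v u).
  move=> u; rewrite inE; case: eqP => [-> //|_ /= urs].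
  by rewrite -scalemxAr (Av u urs) !scalerA mulrC.
rewrite big_cons eqxx big_seq (eq_bigr (fun u => (u - r)^-1 *: v u)).
  by rewrite -big_seq /x' subrK.
by move=> u urs; rewrite (negPf (contraNneq _ r_rs)) // => <-.
Qed.

Section Graph.
Variable R : realType.
Variable m : nat.
Local Notation A := (adjT R m).
Local Notation C := R[i].

Lemma sum_nverts (V : nmodType) (g : nat -> V) :
  \sum_(y < nverts m) g y = g 0%N + g 1%N + g 2%N + g 3%N + g 4%N + g 5%N
    + \sum_(i < m) (g i.*2.+4.+2 + g i.*2.+4.+3).
Proof.
rewrite /nverts; elim: m => [|k IHk]; first by rewrite !big_ord_recl !big_ord0 /= !addr0 !addrA.
rewrite doubleS (big_ord_recr k.*2.+4.+3) (big_ord_recr k.*2.+4.+2) /= IHk (big_ord_recr k) /=.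
by rewrite !addrA.
Qed.

Lemma nverts_ind (P : nat -> Prop) : P 0%N -> P 1%N -> P 2%N -> P 3%N -> P 4%N -> P 5%N ->
  (forall i, (i < m)%N -> P i.*2.+4.+2 /\ P i.*2.+4.+3) ->
  forall x, (x < nverts m)%N -> P x.
Proof.
move=> P0 P1 P2 P3 P4 P5 Pi [|[|[|[|[|[|x]]]]]] //; rewrite /nverts => xm.
have xm2 : (x./2 < m)%N by lia.
have [Pe Po] := Pi _ xm2; rewrite -(odd_double_half x).
by case: (odd x).
Qed.

Lemma tadj_sym x y : tadj m x y = tadj m y x.
Proof. by rewrite /tadj orbC. Qed.

Lemma tadj_lt5 k i : (k < 5)%N ->
  (tadj m k i.*2.+4.+2 = false) * (tadj m k i.*2.+4.+3 = false).
Proof.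
by case: k => [|[|[|[|[|k]]]]] // _; rewrite /tadj /tedge /= !andbF.
Qed.

Lemma ltn_nverts i : (i < m)%N -> (i.*2.+4.+2 < nverts m)%N.
Proof. by move=> im; rewrite /nverts !ltnS ltn_double. Qed.

Lemma tadj_5 i : (i < m)%N ->
  (tadj m 5 i.*2.+4.+2 = true) * (tadj m 5 i.*2.+4.+3 = false).
Proof.
move=> im; split; rewrite /tadj /tedge /= ?odd_double /= ?andbF //.
by rewrite ltn_nverts.
Qed.

Lemma tadj_branch i j : (j < m)%N ->
  (tadj m j.*2.+4.+2 i.*2.+4.+2 = false) * (tadj m j.*2.+4.+2 i.*2.+4.+3 = (i == j)) *
  (tadj m j.*2.+4.+3 i.*2.+4.+3 = false).
Proof.
have parity a b : (a.*2 == b.*2.+1) = false.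
  by apply/negbTE/eqP => /(congr1 odd); rewrite /= !odd_double.
move=> jm; split; [split|]; rewrite /tadj /tedge /= !eqSS !odd_double ?parity ?andbF //=.
by rewrite ltn_nverts //= -!muln2 eqn_pmul2r // orbF.
Qed.

(** Functions on [nat] instead of ordinals keep the vertex numbers concrete, so that adjacency
    computes. *)
Definition adjsum (f : nat -> C) (x : nat) : C := \sum_(y < nverts m) (tadj m x y)%:R * f y.

Lemma adjsumE f : [/\ adjsum f 0 = f 2%N, adjsum f 1 = f 3%N, adjsum f 2 = f 0%N + f 4%N,
  adjsum f 3 = f 1%N + f 4%N & adjsum f 4 = f 2%N + f 3%N + f 5%N] /\
  [/\ adjsum f 5 = f 4%N + \sum_(i < m) f i.*2.+4.+2,
   (forall j, (j < m)%N -> adjsum f j.*2.+4.+2 = f 5%N + f j.*2.+4.+3) &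
   (forall j, (j < m)%N -> adjsum f j.*2.+4.+3 = f j.*2.+4.+2)].
Proof.
have E x (hx : (x < 5)%N) : \sum_(i < m) ((tadj m x i.*2.+4.+2)%:R * f i.*2.+4.+2
    + (tadj m x i.*2.+4.+3)%:R * f i.*2.+4.+3) = 0.
  by rewrite big1 // => i _; rewrite !(tadj_lt5 _ hx) !mul0r addr0.
have S x : adjsum f x = _ := sum_nverts (fun y => (tadj m x y)%:R * f y).
split; split; try (rewrite S E //; rewrite /tadj /tedge /=;
  by rewrite ?mul0r ?mul1r ?add0r ?addr0).
- rewrite S.
  have H k : (k < 6)%N -> tadj m 5 k = (k == 4%N) by case: k => [|[|[|[|[|[|]]]]]].
  rewrite !H //= !mul0r mul1r !add0r addr0; congr (_ + _); apply: eq_bigr => -[i im] _ /=.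
  by rewrite !tadj_5 // mul1r mul0r addr0.
- move=> j jm; have H k : (k < 5)%N -> tadj m j.*2.+4.+2 k = false.
    by move=> k5; rewrite tadj_sym tadj_lt5.
  rewrite S (H 0%N) // (H 1%N) // (H 2%N) // (H 3%N) // (H 4%N) //.
  rewrite [tadj m _ 5]tadj_sym tadj_5 // !mul0r mul1r !add0r; congr (_ + _).
  rewrite (bigD1 (Ordinal jm)) //= big1 ?addr0 => [|[i im] /=].
    by rewrite !tadj_branch // eqxx mul0r mul1r add0r.
  by rewrite -val_eqE /= => /negPf ij; rewrite !tadj_branch // ij !mul0r addr0.
- move=> j jm; have H k : (k < 6)%N -> tadj m j.*2.+4.+3 k = false.
    rewrite tadj_sym ltnS leq_eqVlt => /orP[/eqP->|k5]; first by rewrite tadj_5.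
    by rewrite tadj_lt5.
  rewrite S !H // !mul0r !add0r (bigD1 (Ordinal jm)) //= big1 ?addr0 => [|[i im] /=].
    by rewrite [tadj m j.*2.+4.+3 j.*2.+4.+2]tadj_sym !tadj_branch // eqxx mul0r mul1r addr0.
  rewrite -val_eqE /= => /negPf ij; rewrite [tadj m _ i.*2.+4.+2]tadj_sym !tadj_branch //.
  by rewrite eq_sym ij !mul0r addr0.
Qed.

Definition vcol (f : nat -> C) : 'cV[C]_(nverts m) := \col_y f y.

Lemma adjT_vcol f g : (forall x, (x < nverts m)%N -> adjsum f x = g x) ->
  A *m vcol f = vcol g.
Proof.
move=> fg; apply/colP => x; rewrite !mxE -fg //.
by apply: eq_bigr => y _; rewrite !mxE.
Qed.

Lemma vrow_adjT f (theta : C) : A *m vcol f = theta *: vcol f ->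
  (vcol f)^T *m A = theta *: (vcol f)^T.
Proof.
move=> Af; have AT : A^T = A by apply/matrixP => x y; rewrite !mxE tadj_sym.
by apply: trmx_inj; rewrite trmx_mul !linearZ /= trmxK AT.
Qed.

(* [symf] takes the value [a] on c and d, [b] on e and f, and [p] (resp. [q]) on
   the degree-2 (resp. pendant) vertices of the branches of SK_{1,m}. *)
Definition symf (a b u v p q : C) (k : nat) : C :=
  match k with 0 | 1 => a | 2 | 3 => b | 4 => u | 5 => v
  | _ => if odd k then q else p end.

Definition antif (a b : C) (k : nat) : C :=
  match k with 0 => a | 1 => - a | 2 => b | 3 => - b | _ => 0 end.

Lemma adjT_sym a b u v p q : A *m vcol (symf a b u v p q) =
  vcol (symf b (a + u) (2 * b + v) (u + m%:R * p) (v + q) p).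
Proof.
apply: adjT_vcol.
have [[H0 H1 H2 H3 H4] [H5 H6 H7]] := adjsumE (symf a b u v p q).
apply: nverts_ind; rewrite ?H0 ?H1 ?H2 ?H3 ?H4 ?H5 //=.
- by rewrite mulr_natl mulr2n.
- congr (_ + _); rewrite (eq_bigr (fun=> p)) ?sumr_const ?card_ord ?mulr_natl //.
  by move=> i _; rewrite odd_double.
- by move=> i im; rewrite H6 // H7 //= odd_double.
Qed.

Lemma adjT_anti a b : A *m vcol (antif a b) = vcol (antif b a).
Proof.
apply: adjT_vcol.
have [[H0 H1 H2 H3 H4] [H5 H6 H7]] := adjsumE (antif a b).
apply: nverts_ind; rewrite ?H0 ?H1 ?H2 ?H3 ?H4 ?H5 //= ?addr0 ?subrr //.
- by rewrite big1 ?addr0.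
- by move=> i im; rewrite H6 // H7 //= addr0.
Qed.

Lemma vcolD f g : vcol f + vcol g = vcol (fun k => f k + g k).
Proof. by apply/colP => x; rewrite !mxE. Qed.

Lemma vcolZ a f : a *: vcol f = vcol (fun k => a * f k).
Proof. by apply/colP => x; rewrite !mxE. Qed.

Lemma vcolN f : - vcol f = vcol (fun k => - f k).
Proof. by apply/colP => x; rewrite !mxE. Qed.

Lemma eq_vcol f g : f =1 g -> vcol f = vcol g.
Proof. by move=> fg; apply/colP => x; rewrite !mxE fg. Qed.

Lemma adjT_sym_shift r a b u v p q :
  A *m vcol (symf a b u v p q) - r *: vcol (symf a b u v p q) =
  vcol (symf (b - r * a) (a + u - r * b) (2 * b + v - r * u)
    (u + m%:R * p - r * v) (v + q - r * p) (p - r * q)).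
Proof.
rewrite adjT_sym -scaleNr vcolZ vcolD; apply: eq_vcol.
by do 6![case=> [|] /=; first by rewrite mulNr] => k /=; case: ifP => _; rewrite mulNr.
Qed.

(** On the six parameters of [symf], [A] acts with characteristic polynomial [q]. The hypotheses are
    Vieta's relations for the squares of the roots, so the six shifts compose to [q(A)]. *)
Lemma kill_sym (r1 r2 r3 : C) :
  r1 ^+ 2 + r2 ^+ 2 + r3 ^+ 2 = (m + 5)%:R ->
  r1 ^+ 2 * r2 ^+ 2 + r1 ^+ 2 * r3 ^+ 2 + r2 ^+ 2 * r3 ^+ 2 = (3 * m + 5)%:R ->
  r1 ^+ 2 * r2 ^+ 2 * r3 ^+ 2 = 1 ->
  foldl (fun y r => A *m y - r *: y) (vcol (symf 1 0 0 0 0 0))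
    [:: r1; - r1; r2; - r2; r3; - r3] = 0.
Proof.
move=> e1 e2 e3; rewrite /= !adjT_sym_shift.
set M : C := m%:R.
have E1 : r1 ^+ 2 + r2 ^+ 2 + r3 ^+ 2 = M + 5 by rewrite e1 natrD.
have E2 : r1 ^+ 2 * r2 ^+ 2 + r1 ^+ 2 * r3 ^+ 2 + r2 ^+ 2 * r3 ^+ 2 = 3 * M + 5.
  by rewrite e2 natrD natrM.
apply/colP => x; rewrite !mxE.
suff H k : symf 0 0 0 0 0 0 k = 0.
  rewrite -[RHS](H x); congr symf.
  (* The first, third and fifth parameters need Vieta's relations; the others vanish identically
     because the shifts come in pairs [r], [- r]. *)
  - transitivity (11 - 3 * (r1 ^+ 2 + r2 ^+ 2 + r3 ^+ 2)
      + (r1 ^+ 2 * r2 ^+ 2 + r1 ^+ 2 * r3 ^+ 2 + r2 ^+ 2 * r3 ^+ 2)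
      - r1 ^+ 2 * r2 ^+ 2 * r3 ^+ 2); first by ring.
    by rewrite E1 E2 e3; ring.
  - by ring.
  - transitivity (30 + 2 * M - 8 * (r1 ^+ 2 + r2 ^+ 2 + r3 ^+ 2)
      + 2 * (r1 ^+ 2 * r2 ^+ 2 + r1 ^+ 2 * r3 ^+ 2 + r2 ^+ 2 * r3 ^+ 2)); first by ring.
    by rewrite E1 E2; ring.
  - by ring.
  - transitivity (10 + 2 * M - 2 * (r1 ^+ 2 + r2 ^+ 2 + r3 ^+ 2)); first by ring.
    by rewrite E1; ring.
  - by ring.
by case: k => [|[|[|[|[|[|k]]]]]] //=; case: ifP.
Qed.

(** Start from the value 1 at [c] and [d] and propagate the eigenvalue equation: towards the centre
    it gives [D] and [v], and on the branches of SK_{1,m} it is solved by dividing by [D]. The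
    remaining equation, at the vertex 5, is [q(theta) = 0]. *)
Lemma sym_eigenvector (theta : C) : theta ^+ 2 != 1 ->
  theta ^+ 6 - (m + 5)%:R * theta ^+ 4 + (3 * m + 5)%:R * theta ^+ 2 - 1 = 0 ->
  exists u v p q, A *m vcol (symf 1 theta u v p q) = theta *: vcol (symf 1 theta u v p q).
Proof.
move=> th1 q0; pose D := theta ^+ 2 - 1; have D0 : D != 0 by rewrite subr_eq0.
pose v := theta ^+ 3 - 3 * theta.
exists D, v, (theta * v / D), (v / D).
rewrite adjT_sym vcolZ; apply: eq_vcol.
have H : D + m%:R * (theta * v / D) = theta * v.
  apply: (mulIf D0); rewrite mulrDl -!mulrA mulVf // mulr1.
  apply/eqP; rewrite -subr_eq0 -oppr_eq0 -[X in _ == X]q0 natrD natrD natrM.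
  by apply/eqP; rewrite /v /D; ring.
have H' : v + v / D = theta * (theta * v / D).
  by apply: (mulIf D0); rewrite mulrDl -!mulrA mulVf // !mulr1 /D; ring.
case=> [|[|[|[|[|[|k]]]]]] /=; rewrite ?mulr1 //.
- by rewrite /D; ring.
- by rewrite /D; ring.
- by rewrite /v /D; ring.
- by rewrite !negbK; case: (odd k); [rewrite mulrA | exact: H'].
Qed.

End Graph.

(** * Roots of q and transfer times *)

Section RealRoots.
Variables (R : realType) (m : nat).
Hypothesis m_gt0 : (0 < m)%N.
Let M : R := m%:R.

(** The cubic whose value at [x ^+ 2] is [q(x)]. *)
Definition cubicT : {poly R} :=
  'X^3 - (M + 5)%:P * 'X^2 + (3 * M + 5)%:P * 'X - 1.

Lemma cubicTE y : cubicT.[y] = y ^+ 3 - (M + 5) * y ^+ 2 + (3 * M + 5) * y - 1.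
Proof. by rewrite /cubicT !hornerE. Qed.

(** The cubic takes the values [-1], [2 * M], [-4] and a positive one at [0], [1], [3] and [M + 5],
    hence has three distinct positive roots, whose square roots are taken. *)
Lemma real_roots : exists r1 r2 r3 : R,
  [/\ 0 < r1, r1 < r2 & r2 < r3] /\
  [/\ r1 ^+ 2 + r2 ^+ 2 + r3 ^+ 2 = M + 5,
    r1 ^+ 2 * r2 ^+ 2 + r1 ^+ 2 * r3 ^+ 2 + r2 ^+ 2 * r3 ^+ 2 = 3 * M + 5 &
    r1 ^+ 2 * r2 ^+ 2 * r3 ^+ 2 = 1].
Proof.
have M1 : 1 <= M by rewrite /M ler1n.
have [y1 /andP[y1l y1u] /rootP y1P] : exists2 y, 0 <= y <= 1 & root cubicT y.
  by apply: poly_ivt; rewrite ?ler01 // !cubicTE; apply/andP; split; lra.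
have [y2 /andP[y2l y2u] /rootP y2P] : exists2 y, 1 <= y <= 3 & root (- cubicT) y.
  by apply: poly_ivt; rewrite ?hornerN ?cubicTE; last (apply/andP; split); lra.
have [y3 /andP[y3l y3u] /rootP y3P] : exists2 y, 3 <= y <= M + 5 & root cubicT y.
  apply: poly_ivt; rewrite ?cubicTE; first by lra.
  by apply/andP; split; nra.
move: y1P y2P y3P; rewrite hornerN !cubicTE => y1P /eqP; rewrite oppr_eq0 => /eqP y2P y3P.
have y1_gt0 : 0 < y1.
  by rewrite lt_def y1l andbT; apply/eqP => y0; move: y1P; rewrite y0; lra.
have y1_lt1 : y1 < 1.
  by rewrite lt_def y1u andbT; apply/eqP => y0; move: y1P; rewrite -y0; lra.
have y2_gt1 : 1 < y2.
  by rewrite lt_def y2l andbT; apply/eqP => y0; move: y2P; rewrite y0; lra.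
have y2_lt3 : y2 < 3.
  by rewrite lt_def y2u andbT; apply/eqP => y0; move: y2P; rewrite -y0; lra.
have y3_gt3 : 3 < y3.
  by rewrite lt_def y3l andbT; apply/eqP => y0; move: y3P; rewrite y0; lra.
have d12 : y1 - y2 != 0 by rewrite subr_eq0 lt_eqF //; lra.
have d13 : y1 - y3 != 0 by rewrite subr_eq0 lt_eqF //; lra.
have d23 : y2 - y3 != 0 by rewrite subr_eq0 lt_eqF //; lra.
(* Divided differences of the cubic, from which Vieta's relations follow. *)
have q12 : y1 ^+ 2 + y1 * y2 + y2 ^+ 2 - (M + 5) * (y1 + y2) + (3 * M + 5) = 0.
  by apply: (mulfI d12); rewrite mulr0 -[RHS](subrr 0) -[X in _ = X - _]y1P -[X in _ = _ - X]y2P; ring.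
have q13 : y1 ^+ 2 + y1 * y3 + y3 ^+ 2 - (M + 5) * (y1 + y3) + (3 * M + 5) = 0.
  by apply: (mulfI d13); rewrite mulr0 -[RHS](subrr 0) -[X in _ = X - _]y1P -[X in _ = _ - X]y3P; ring.
have e1 : y1 + y2 + y3 = M + 5.
  apply: (mulfI d23); apply/eqP; rewrite -subr_eq0; apply/eqP.
  by rewrite -[RHS](subrr 0) -[X in _ = X - _]q12 -[X in _ = _ - X]q13; ring.
have e2 : y1 * y2 + y1 * y3 + y2 * y3 = 3 * M + 5.
  have -> : y3 = M + 5 - y1 - y2 by rewrite -e1; ring.
  by lra.
have e3 : y1 * y2 * y3 = 1.
  have : y1 ^+ 3 - (y1 + y2 + y3) * y1 ^+ 2 + (y1 * y2 + y1 * y3 + y2 * y3) * y1 - 1 = 0.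
    by rewrite e1 e2.
  by lra.
exists (Num.sqrt y1), (Num.sqrt y2), (Num.sqrt y3).
rewrite !sqr_sqrtr ?sqrtr_gt0 ?ltr_sqrt; try lra.
by do !split => //; lra.
Qed.

End RealRoots.

Section Approximation.
Local Open Scope classical_set_scope.
Variable R : realType.

(** Approximate with error [1 / (k + 1)]; cosines tending to 1 force the sines to tend to 0. *)
Lemma odd_times (L : R -> Prop) (s : seq R) :
  L 0 -> (forall a b, L a -> L b -> L (a - b)) ->
  (forall n : int, L n%:~R -> exists k : int, n = k *+ 2) ->
  (forall t, t \in s -> L t) ->
  exists2 tau : nat -> R, (forall k, oddpi R (tau k)) &
    forall t, t \in s -> ccvg (fun k => expi (tau k * t)) 1.
Proof.
move=> L0 LB Leven Ls.
have /choice[K HK] (k : nat) : exists j : nat,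
    forall t, t \in s -> 1 - k.+1%:R^-1 < cos (t * (pi * (2 * j + 1)%:R)).
  by apply: odd_simultaneous_approximation Ls _ => //; rewrite invr_gt0.
exists (fun k => pi * (2 * K k + 1)%:R) => [k|t ts].
  exists (K k : int); have -> : (K k : int) *+ 2 + 1 = (2 * K k + 1)%N by lia.
  by rewrite -pmulrn mulrC.
have cos_cvg : cos (pi * (2 * K k + 1)%:R * t) @[k --> \oo] --> (1 : R).
  apply: (@squeeze_cvgr _ _ _ _ (fun k => 1 - harmonic k) (fun=> 1)).
  - near=> k; rewrite cos_le1 andbT ltW // mulrC.
    exact: HK.
  - rewrite -[X in _ --> X]subr0; apply: cvgB; first exact: cvg_cst.
    exact: cvg_harmonic.
  - exact: cvg_cst.
split=> //=; apply: norm_cvg0.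
have : Num.sqrt (1 - cos (pi * (2 * K k + 1)%:R * t) * cos (pi * (2 * K k + 1)%:R * t))
    @[k --> \oo] --> (Num.sqrt (1 - 1 * 1) : R).
  apply: continuous_cvg; first exact: sqrt_continuous.
  by apply: cvgB; [exact: cvg_cst | exact: (cvgM cos_cvg cos_cvg)].
rewrite mulr1 subrr sqrtr0; under eq_fun do rewrite -expr2 -sin2cos2 sqrtr_sqr.
by [].
Unshelve. all: by end_near. Qed.

End Approximation.

(** Write [2 e_a] as [(e_a + e_b) + (e_a - e_b)]. In the limit [U(tau k)] fixes the first summand,
    and at odd multiples of [pi] it negates the second, so [e_a] goes to [e_b] with phase 1. *)
Lemma pgst_of_decomposition (R : realType) n (A : 'M[R[i]]_n) (a b : 'I_n)
    (rs : seq R) (v : R -> 'cV[R[i]]_n) (p p' : 'cV[R[i]]_n) (tau : nat -> R) :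
  (forall r, r \in rs -> A *m v r = r%:C%C *: v r) ->
  delta_mx a 0 + delta_mx b 0 = \sum_(r <- rs) v r ->
  A *m p = p -> A *m p' = - p' -> delta_mx a 0 - delta_mx b 0 = p + p' ->
  (forall k, oddpi R (tau k)) ->
  (forall r, r \in rs -> ccvg (fun k => expi (tau k * r)) 1) ->
  pgst_wrt A (oddpi R) a b.
Proof.
move=> Av Dv Ap Ap' Dp tau_odd tau_cvg.
exists tau; split=> //; exists 1 => x.
have expi_odd t : oddpi R t -> expi t = -1 /\ expi (- t) = -1.
  move=> [z ->]; have -> : (z *+ 2 + 1)%:~R * pi = pi * (z *+ 2)%:~R + pi :> R.
    by rewrite rmorphD /=; ring.
  have E : expi (pi * (z *+ 2)%:~R + pi) = -1 :> R[i].
    rewrite /expi sinDpi cosDpi sin_intpi oppr0.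
    have -> : pi * (z *+ 2)%:~R = (pi * z%:~R) *+ 2 :> R by rewrite rmorphMn /=; ring.
    rewrite cos_mulr2n cos2sin2 sin_intpi expr0n subr0 mulr2n addrK.
    by apply/eqP; rewrite eq_complex /= oppr0 !eqxx.
  split=> //; move: E; set y := _ + pi => Ey.
  by have := expi_conj y; rewrite Ey mulN1r => /eqP; rewrite eqr_oppLR => /eqP.
have UE k : Umat A (tau k) x a =
    2^-1 * ((\sum_(r <- rs) expi (tau k * r) * v r x 0) - (p + p') x 0).
  have [E E'] := expi_odd _ (tau_odd k).
  have Up : Umat A (tau k) *m p = - p.
    by rewrite (@Umat_eigencol _ _ _ _ 1) ?mulr1 ?E ?scaleN1r // scale1r.
  have Up' : Umat A (tau k) *m p' = - p'.
    rewrite (@Umat_eigencol _ _ _ _ (-1)) ?mulrN1 ?E' ?scaleN1r //.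
    by rewrite rmorphN1 scaleN1r.
  have Uv : Umat A (tau k) *m \sum_(r <- rs) v r = \sum_(r <- rs) expi (tau k * r) *: v r.
    rewrite mulmx_sumr big_seq [RHS]big_seq; apply: eq_bigr => r rr.
    by rewrite (Umat_eigencol _ (Av r rr)).
  have : Umat A (tau k) *m (delta_mx a 0 + delta_mx b 0) +
      Umat A (tau k) *m (delta_mx a 0 - delta_mx b 0) =
      \sum_(r <- rs) expi (tau k * r) *: v r - (p + p').
    by rewrite Dv Dp Uv mulmxDr Up Up' opprD.
  rewrite -mulmxDr addrACA subrr addr0 mulmxDr -colE => /colP/(_ x).
  rewrite !mxE summxE => D.
  apply: (@mulfI _ 2); first by rewrite pnatr_eq0.
  rewrite mulrA mulfV ?pnatr_eq0 // mul1r mulr_natl mulr2n D; congr (_ - _).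
  by apply: eq_bigr => r _; rewrite mxE.
apply: ccvg_eq UE _.
have -> : (if x == b then 1 else 0 : R[i]) =
    2^-1 * (\sum_(r <- rs) 1 * v r x 0 + - (p + p') x 0).
  have -> : \sum_(r <- rs) 1 * v r x 0 = (delta_mx a 0 + delta_mx b 0 : 'cV[R[i]]_n) x 0.
    by rewrite Dv summxE; apply: eq_bigr => r _; rewrite mul1r.
  rewrite -Dp !mxE eqxx !andbT.
  apply: (@mulfI _ 2); first by rewrite pnatr_eq0.
  by rewrite mulrA mulfV ?pnatr_eq0 // mul1r; move: ((x == a)%:R) => c; case: (x == b); rewrite /= ?mulr1n ?mulr0n; ring.
apply: ccvgM; first exact: ccvg_cst.
apply: ccvgD; last exact: ccvg_cst.
apply: ccvg_sum => r rr; apply: ccvgM; last exact: ccvg_cst.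
exact: tau_cvg.
Qed.

(** * Transfer and its obstruction *)

Lemma delta_vcol (R : realType) m k : (k < nverts m)%N ->
  delta_mx (inord k : 'I_(nverts m)) 0 = vcol m (fun y => (y == k)%:R : R[i]).
Proof.
move=> km; apply/colP => x; rewrite !mxE eqxx andbT -val_eqE /= inordK //.
Qed.

Lemma pgst_T2m (R : realType) m (r1 r2 r3 : R) (tau : nat -> R) :
  [/\ 0 < r1, r1 < r2 & r2 < r3] ->
  [/\ r1 ^+ 2 + r2 ^+ 2 + r3 ^+ 2 = m%:R + 5,
    r1 ^+ 2 * r2 ^+ 2 + r1 ^+ 2 * r3 ^+ 2 + r2 ^+ 2 * r3 ^+ 2 = 3 * m%:R + 5 &
    r1 ^+ 2 * r2 ^+ 2 * r3 ^+ 2 = 1] ->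
  (forall k, oddpi R (tau k)) ->
  (forall r, r \in [:: r1; - r1; r2; - r2; r3; - r3] ->
     ccvg (fun k => expi (tau k * r)) 1) ->
  pgst_wrt (adjT R m) (oddpi R) (vc m) (vd m) /\
  pgst_wrt (adjT R m) (oddpi R) (ve m) (vf m).
Proof.
move=> [r1_gt0 r12 r23] [e1 e2 e3] tau_odd tau_cvg.
set rs := [:: r1; _; _; _; _; _] in tau_cvg.
have rs_uniq : uniq rs.
  by rewrite /= !inE !negb_or; do !(apply/andP; split) => //; apply/eqP; lra.
have /eigenvector_decomposition[|v Av Dv] : foldl (fun y r => adjT R m *m y - r *: y)
    (vcol m (symf 1 0 0 0 0 0)) [seq r%:C%C | r <- rs] = 0.
- rewrite /= !rmorphN; apply: kill_sym; rewrite -!rmorphXn -?rmorphM -?rmorphD /=.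
  + by rewrite e1 natrD !rmorphD !rmorph_nat.
  + by rewrite e2 natrD natrM !rmorphD rmorphM !rmorph_nat.
  + by rewrite e3.
- by rewrite map_inj_uniq //; apply: fmorph_inj.
rewrite big_map in Dv.
have {}Av r : r \in rs -> adjT R m *m v r%:C%C = r%:C%C *: v r%:C%C.
  by move=> rr; apply: Av; apply: map_f.
pose h : R[i] := 2^-1.
have hh : h + h = 1 by rewrite /h -mulr2n -[_ *+ 2]mulr_natl mulfV // pnatr_eq0.
have n4 k : (k < 4)%N -> (k < nverts m)%N by move=> k4; rewrite /nverts; lia.
have Ap : adjT R m *m vcol m (antif h h) = vcol m (antif h h) by rewrite adjT_anti.
have Ap' : adjT R m *m vcol m (antif h (- h)) = - vcol m (antif h (- h)).
  rewrite adjT_anti vcolN; apply: eq_vcol.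
  by case=> [|[|[|[|k]]]] /=; ring.
split.
- apply: (@pgst_of_decomposition _ _ _ _ _ rs (fun r => v r%:C%C)
    (vcol m (antif h h)) (vcol m (antif h (- h))) tau) => //.
    rewrite -Dv !delta_vcol ?n4 // vcolD; apply: eq_vcol.
    by case=> [|[|[|[|[|[|k]]]]]] /=; rewrite ?addr0 ?add0r //; case: ifP.
  rewrite !delta_vcol ?n4 // vcolN !vcolD; apply: eq_vcol.
  by case=> [|[|[|[|k]]]] /=; rewrite -?opprD ?hh; ring.
(* [A] maps [e_c + e_d] to [e_e + e_f], so the components of the latter are those of the former
   multiplied by their eigenvalues. *)
- apply: (@pgst_of_decomposition _ _ _ _ _ rs (fun r => r%:C%C *: v r%:C%C)
    (vcol m (antif h h)) (vcol m (antif (- h) h)) tau) => //.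
  + by move=> r rr; rewrite -scalemxAr Av.
  + transitivity (adjT R m *m vcol m (symf 1 0 0 0 0 0)).
      rewrite adjT_sym !delta_vcol ?n4 // vcolD; apply: eq_vcol.
      by case=> [|[|[|[|[|[|k]]]]]] /=; rewrite ?mulr0 ?addr0 ?add0r //; case: ifP.
    rewrite Dv mulmx_sumr big_seq [RHS]big_seq; apply: eq_bigr => r rr.
    by rewrite Av.
  + rewrite adjT_anti vcolN; apply: eq_vcol.
    by case=> [|[|[|[|k]]]] /=; ring.
  + rewrite !delta_vcol ?n4 // vcolN !vcolD; apply: eq_vcol.
    by case=> [|[|[|[|k]]]] /=; rewrite -?opprD ?hh; ring.
Qed.

Section NoTransfer.
Variables (R : realType).

Lemma ccvgX (z : nat -> R[i]) (a : R[i]) n : ccvg z a -> ccvg (fun k => z k ^+ n) (a ^+ n).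
Proof.
move=> za; elim: n => [|n IHn]; first exact: ccvg_cst.
rewrite exprS; apply: ccvg_eq (ccvgM za IHn) => k; exact: exprS.
Qed.

(** Pairing the column [U(tau k) e_a] with a left eigenvector isolates the single phase
    [expi (tau k * theta)]. *)
Lemma eigenrow_limit n (A : 'M[R[i]]_n) (a b : 'I_n) (tau : nat -> R) gamma
    (theta : R) (w : 'rV[R[i]]_n) :
  (forall x, ccvg (fun k => Umat A (tau k) x a) (if x == b then gamma else 0)) ->
  w *m A = theta%:C%C *: w ->
  ccvg (fun k => expi (tau k * theta) * w 0 a) (w 0 b * gamma).
Proof.
move=> U_cvg wA.
have -> : w 0 b * gamma = \sum_x w 0 x * (if x == b then gamma else 0).
  by rewrite (bigD1 b) //= eqxx big1 ?addr0 // => x /negPf->; rewrite mulr0.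
apply: (@ccvg_eq _ _ (fun k => \sum_x w 0 x * Umat A (tau k) x a)) => [k|].
  have /rowP/(_ a) := Umat_eigenrow (tau k) wA.
  by rewrite [RHS]mxE => <-; rewrite [LHS]mxE.
by apply: ccvg_sum => x _; apply: ccvgM; [exact: ccvg_cst | exact: U_cvg].
Qed.

(** The phases for [theta] and [- theta] are inverse to each other, which leaves a relation free of
    [tau]. *)
Lemma expi_limit_product (tau : nat -> R) (theta : R) (a b c d : R[i]) :
  ccvg (fun k => expi (tau k * theta) * a) c ->
  ccvg (fun k => expi (tau k * - theta) * b) d -> a * b = c * d.
Proof.
move=> Ha Hb; apply: (ccvg_unique _ (ccvgM Ha Hb)).
apply: ccvg_eq (ccvg_cst (a * b)) => k.
by rewrite mulrACA mulrN expi_conj mul1r.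
Qed.

Lemma ccvg_divr (z : nat -> R[i]) (c d e : R[i]) : c != 0 ->
  ccvg (fun k => z k * c) d -> d = e * c -> ccvg z e.
Proof.
move=> c0 zc De; have -> : e = d / c by rewrite De mulfK.
by apply: ccvg_eq (ccvgM zc (ccvg_cst c^-1)) => k; rewrite mulfK.
Qed.

(* At these times [expi] of an odd multiple of [tau] tends to [- gamma]
   while the product over the [z i] tends to [gamma ^+ 3 = gamma]. *)
Lemma odd_sum_obstruction (tau : nat -> R) (gamma : R[i]) (z1 z2 z3 : R) (k : int) :
  gamma ^+ 2 = 1 -> z1 + z2 + z3 = (k *+ 2 + 1)%:~R ->
  ccvg (fun n => expi (tau n * 1)) (- gamma) ->
  ccvg (fun n => expi (tau n * -1)) (- gamma) ->
  ccvg (fun n => expi (tau n * z1)) gamma ->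
  ccvg (fun n => expi (tau n * z2)) gamma ->
  ccvg (fun n => expi (tau n * z3)) gamma -> False.
Proof.
move=> g2 sumz Hp Hm H1 H2 H3.
have lim1 : ccvg (fun n => expi (tau n * (k *+ 2 + 1)%:~R)) gamma.
  have -> : gamma = gamma * gamma * gamma by rewrite -expr2 g2 mul1r.
  apply: ccvg_eq (ccvgM (ccvgM H1 H2) H3) => n.
  by rewrite -sumz !mulrDr !expiD.
(* [e] is the sign of the odd integer and [N.*2.+1] its absolute value. *)
have [e [e1 [N Dk]]] : exists e : R, ccvg (fun n => expi (tau n * e)) (- gamma) /\
    exists N : nat, (k *+ 2 + 1)%:~R = e *+ N.*2.+1.
  case: k {sumz lim1} => j.
    exists 1; split=> //; exists j.
    have -> : (Posz j) *+ 2 + 1 = Posz j.*2.+1 by lia.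
    by rewrite -pmulrn.
  exists (-1); split=> //; exists j.
  have -> : (Negz j) *+ 2 + 1 = - Posz j.*2.+1 by lia.
  by rewrite mulrNz mulNrn.
have lim2 : ccvg (fun n => expi (tau n * (k *+ 2 + 1)%:~R)) ((- gamma) ^+ N.*2.+1).
  by apply: ccvg_eq (ccvgX _ e1) => n; rewrite Dk mulrnAr expiMn.
have := ccvg_unique lim1 lim2.
rewrite exprS -muln2 mulnC exprM sqrrN g2 expr1n mulr1 => /eqP.
rewrite -subr_eq0 opprK -mulr2n mulrn_eq0 /= => /eqP g0.
by move/eqP: g2; rewrite g0 expr0n /= eq_sym oner_eq0.
Qed.

(** Three kinds of target [b]: outside the four vertices the antisymmetric eigenvectors vanish at
    [b] but not at [a]; in the other pair, the relations for the eigenvalues [1], [-1] and [z1],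
    [- z1] give [z1 ^+ 2 = 1]; within the pair of [a], the odd sum is contradictory. *)
Lemma no_pgst_T2m m (z1 z2 z3 : R) (k : int) (a b : 'I_(nverts m)) : (0 < m)%N ->
  (forall z, z \in [:: z1; z2; z3] ->
     z ^+ 6 - (m + 5)%:R * z ^+ 4 + (3 * m + 5)%:R * z ^+ 2 - 1 = 0) ->
  z1 + z2 + z3 = (k *+ 2 + 1)%:~R ->
  a \in [:: vc m; vd m; ve m; vf m] -> b != a -> ~ pgst (adjT R m) a b.
Proof.
move=> m_gt0 qz sumz a4 ba [tau [_ [gamma U_cvg]]].
have m_neq0 : m%:R != 0 :> R by rewrite pnatr_eq0 -lt0n.
have na4 : (a < 4)%N.
  move: a4; rewrite !inE /vc /vd /ve /vf => /or4P[] /eqP->; rewrite inordK //.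
have nba : (b : nat) != a by [].
have z_neq0 z : z \in [:: z1; z2; z3] -> z%:C%C != 0 :> R[i].
  move=> /qz; rewrite fmorph_eq0; apply: contra_eqN => /eqP->.
  by rewrite !expr0n /= !mulr0 subr0 add0r sub0r oppr_eq0 oner_eq0.
have z_neq1 z : z \in [:: z1; z2; z3] -> z%:C%C ^+ 2 <> 1 :> R[i].
  move=> /qz qz0; rewrite -rmorphXn => /(fmorph_inj (real_complex R)) zz.
  (* At [z ^+ 2 = 1] the sextic takes the value [2 * m]. *)
  move: qz0; have -> : z ^+ 6 = (z ^+ 2) ^+ 3 by rewrite -exprM.
  have -> : z ^+ 4 = (z ^+ 2) ^+ 2 by rewrite -exprM.
  rewrite zz (natrD _ m) (natrD _ (3 * m)) (natrM _ 3) => H; have : 2 * m%:R = 0 :> R by rewrite -H; ring.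
  by apply/eqP; rewrite mulf_neq0 // pnatr_eq0.
have anti_limit s : s ^+ 2 = 1 -> ccvg (fun n => expi (tau n * s) * antif 1 s%:C%C a)
    (antif 1 s%:C%C b * gamma).
  move=> s2; have := @eigenrow_limit _ _ a b tau gamma s (vcol m (antif 1 s%:C%C))^T U_cvg.
  rewrite !mxE; apply; apply: vrow_adjT; rewrite adjT_anti vcolZ; apply: eq_vcol.
  have sC2 : s%:C%C * s%:C%C = 1 :> R[i] by rewrite -rmorphM /= -expr2 s2.
  by case=> [|[|[|[|j]]]] /=; rewrite ?mulr1 ?mulrN1 ?mulrN ?sC2 ?mulr0.
have sym_limit z : z ^+ 6 - (m + 5)%:R * z ^+ 4 + (3 * m + 5)%:R * z ^+ 2 - 1 = 0 ->
    z%:C%C ^+ 2 <> 1 :> R[i] ->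
    exists u v p q, ccvg (fun n => expi (tau n * z) * symf 1 z%:C%C u v p q a)
      (symf 1 z%:C%C u v p q b * gamma).
  move=> qz0 z1'; have [||u [v [p [q Aw]]]] := @sym_eigenvector R m z%:C%C.
  - exact/eqP.
  - have := congr1 (real_complex R) qz0.
    by rewrite !(rmorphB, rmorphD, rmorphM, rmorphXn, rmorph_nat, rmorph1, rmorph0).
  exists u, v, p, q.
  have := @eigenrow_limit _ _ a b tau gamma z (vcol m (symf 1 z%:C%C u v p q))^T U_cvg.
  by rewrite !mxE; apply; apply: vrow_adjT.
have Hp : ccvg (fun n => expi (tau n * 1) * antif 1 1 a) (antif 1 1 b * gamma).
  exact: anti_limit (expr1n _ _).
have Hm : ccvg (fun n => expi (tau n * -1) * antif 1 (-1) a) (antif 1 (-1) b * gamma).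
  by have := anti_limit (-1); rewrite sqrrN expr1n rmorphN1; apply.
have z1_in : z1 \in [:: z1; z2; z3] by rewrite !inE eqxx.
have z2_in : z2 \in [:: z1; z2; z3] by rewrite !inE eqxx orbT.
have z3_in : z3 \in [:: z1; z2; z3] by rewrite !inE eqxx !orbT.
have [u [v [p [q Hz]]]] := sym_limit _ (qz _ z1_in) (z_neq1 _ z1_in).
have [||u' [v' [p' [q' Hz']]]] := sym_limit (- z1).
- by apply: etrans (qz _ z1_in); ring.
- by rewrite rmorphN sqrrN; apply: z_neq1.
rewrite rmorphN in Hz'.
have P1 := expi_limit_product Hp Hm.
have P2 := expi_limit_product Hz Hz'.
have nz1 := z_neq1 _ z1_in.
move: (nat_of_ord a) (nat_of_ord b) na4 nba Hp Hm sym_limit P1 P2 {Hz Hz'}.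
move=> na nb na4 nba Hp Hm sym_limit P1 P2.
(* Target within the pair of [a]: antisymmetric eigenvectors change sign between [a] and [b],
   symmetric ones agree. *)
have same : antif 1 1 nb = - antif 1 1 na :> R[i] ->
    antif 1 (-1) nb = - antif 1 (-1) na :> R[i] ->
    (forall t u v p q, symf 1 t u v p q nb = symf 1 t u v p q na :> R[i]) ->
    antif 1 1 na != 0 :> R[i] -> antif 1 (-1) na != 0 :> R[i] ->
    (forall t u v p q, t != 0 -> symf 1 t u v p q na != 0 :> R[i]) -> False.
  move=> Eb Eb' Es a0 a0' s0; rewrite Eb Eb' in P1.
  have g2 : gamma ^+ 2 = 1.
    by apply: (mulfI (mulf_neq0 a0 a0')); rewrite mulr1 [RHS]P1; ring.
  have limz z : z \in [:: z1; z2; z3] -> ccvg (fun n => expi (tau n * z)) gamma.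
    move=> zin.
    have [u1 [v1 [p1 [q1 H]]]] := sym_limit _ (qz _ zin) (z_neq1 _ zin).
    by apply: ccvg_divr (s0 _ _ _ _ _ (z_neq0 _ zin)) H _; rewrite Es mulrC.
  apply: (odd_sum_obstruction g2 sumz _ _ (limz _ z1_in) (limz _ z2_in) (limz _ z3_in)).
    by apply: ccvg_divr a0 Hp _; rewrite Eb; ring.
  by apply: ccvg_divr a0' Hm _; rewrite Eb'; ring.
(* Eliminates [gamma ^+ 2] between [P1] and [P2]. *)
have Q : antif 1 1 nb * antif 1 (-1) nb * (symf 1 z1%:C%C u v p q na * symf 1 (- z1%:C%C) u' v' p' q' na)
    = symf 1 z1%:C%C u v p q nb * symf 1 (- z1%:C%C) u' v' p' q' nb * (antif 1 1 na * antif 1 (-1) na).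
  by rewrite P1 P2; ring.
have ne1 : 1 != 0 :> R[i] := oner_neq0 _.
have ne2 : -1 != 0 :> R[i] by rewrite oppr_eq0.
case: na na4 nba {Hp Hm sym_limit P2} P1 Q same => [|[|[|[|na]]]] // _ nba P1 Q same;
  case: nb nba P1 Q same => [|[|[|[|nb]]]] //= _ P1 Q same;
  try (by apply: same; rewrite ?opprK // => *; rewrite ?oppr_eq0);
  try (by apply: nz1; apply: oppr_inj; apply: (etrans _ (etrans Q _)); ring);
  try (by apply: nz1; apply: oppr_inj; apply: (etrans _ (etrans (esym Q) _)); ring);
  move/eqP: P1; rewrite !mul0r ?mulrN ?mulNr ?mulr1 ?opprK ?oppr_eq0 ?(negPf ne1) //.
Qed.
End NoTransfer.

(** * Integral combinations of the roots and coefficients of [q] *)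

Section IntegerSpan.
Variable R : realType.

(** Serves as the frequency group [L]; an integer in it is a relation to which [trace_relation]
    applies. *)
Definition zspan (s : seq R) (a : R) : Prop :=
  exists l : 'I_(size s) -> int, a = \sum_j (l j)%:~R * s`_j.

Lemma zspan0 s : zspan s 0.
Proof. by exists (fun=> 0); rewrite big1 // => j _; rewrite mul0r. Qed.

Lemma zspanB s a b : zspan s a -> zspan s b -> zspan s (a - b).
Proof.
move=> [l ->] [l' ->]; exists (fun j => l j - l' j).
by rewrite -sumrB; apply: eq_bigr => j _; rewrite rmorphB mulrBl.
Qed.

Lemma mem_zspan s a : a \in s -> zspan s a.
Proof.
move=> /(nthP 0)[j js <-]; exists (fun i => (i == Ordinal js)%:R).
rewrite (bigD1 (Ordinal js)) //= eqxx mul1r big1 ?addr0 // => i /negPf->.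
by rewrite mul0r.
Qed.

End IntegerSpan.

Section Sextic.
Variable m : nat.

Lemma size_q_T2m : size (q_T2m m) = 7%N.
Proof.
rewrite /q_T2m -!addrA size_polyDl size_polyXn //.
rewrite (leq_ltn_trans (size_polyD _ _)) // gtn_max size_polyN.
rewrite (leq_ltn_trans (size_scale_leq _ _)) ?size_polyXn //=.
rewrite (leq_ltn_trans (size_polyD _ _)) // gtn_max size_polyN size_poly1 andbT.
by rewrite (leq_ltn_trans (size_scale_leq _ _)) ?size_polyXn.
Qed.

Lemma monic_q_T2m : q_T2m m \is monic.
Proof.
rewrite monicE lead_coefE size_q_T2m /q_T2m !coefE /=.
by rewrite !mulr0 subr0 addr0 subr0.
Qed.

Lemma coef5_q_T2m : (q_T2m m)`_5 = 0.
Proof. by rewrite /q_T2m !coefE /= !mulr0 !subr0. Qed.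

Lemma q_T2mE (K : numFieldType) (z : K) : (map_poly ratr (q_T2m m)).[z] =
  z ^+ 6 - (m + 5)%:R * z ^+ 4 + (3 * m + 5)%:R * z ^+ 2 - 1.
Proof.
rewrite /q_T2m; move: (m + 5)%N (3 * m + 5)%N => u v.
rewrite !rmorphD !rmorphN /= !map_polyZ /= !map_polyXn rmorph1 /=.
by rewrite !ratr_nat !hornerE.
Qed.

End Sextic.

Lemma coef2_prod_XsubC3 (F : comNzRingType) (a b c : F) :
  (('X - a%:P) * ('X - b%:P) * ('X - c%:P))`_2 = - (a + b + c).
Proof.
have -> : ('X - a%:P) * ('X - b%:P) * ('X - c%:P) = 'X^3 - (a + b + c)%:P * 'X^2
    + (a * b + a * c + b * c)%:P * 'X - (a * b * c)%:P :> {poly F}.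
  by rewrite !polyCD !polyCM; ring.
by rewrite !coefE /=; ring.
Qed.

Theorem theorem3p3 (R : realType) (m : nat) (hm : (0 < m)%N) :
  (irreducible_poly (q_T2m m) ->
     pgst_wrt (adjT R m) (oddpi R) (vc m) (vd m) /\
     pgst_wrt (adjT R m) (oddpi R) (ve m) (vf m)) /\
  (~ irreducible_poly (q_T2m m) ->
   forall (f : {poly rat}) (th1 th2 th3 : algC),
     f \is monic -> size f = 4%N -> irreducible_poly f ->
     q_T2m m = - (f * (f \Po (- 'X))) ->
     map_poly ratr f = ('X - th1%:P) * ('X - th2%:P) * ('X - th3%:P) ->
     ((exists k : int, th1 + th2 + th3 = (k *+ 2)%:~R) ->
        pgst_wrt (adjT R m) (oddpi R) (vc m) (vd m) /\
        pgst_wrt (adjT R m) (oddpi R) (ve m) (vf m)) /\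
     ((exists k : int, th1 + th2 + th3 = (k *+ 2 + 1)%:~R) ->
        forall a b : 'I_(nverts m),
          a \in [:: vc m; vd m; ve m; vf m] -> b != a ->
          ~ pgst (adjT R m) a b)).
Proof.
have [r1 [r2 [r3 [r_lt e123]]]] := real_roots R hm.
have [r1_gt0 r12 r23] := r_lt; have [e1 e2 e3] := e123.
have qr r : r \in [:: r1; r2; r3] ->
    r ^+ 6 - (m + 5)%:R * r ^+ 4 + (3 * m + 5)%:R * r ^+ 2 - 1 = 0.
  rewrite (natrD _ m) (natrD _ (3 * m)) (natrM _ 3) -e1 -e2 -[X in _ - X = _]e3 !inE.
  by move=> /or3P[] /eqP->; ring.
(* The span is closed under opposites, so [s] need only contain each root up to sign; in the
   reducible case the signs are those of the roots of [f]. *)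
have transfer (s : seq R) : (forall r, r \in [:: r1; r2; r3] -> r \in s \/ - r \in s) ->
    (forall n : int, zspan s n%:~R -> exists k : int, n = k *+ 2) ->
    pgst_wrt (adjT R m) (oddpi R) (vc m) (vd m) /\
    pgst_wrt (adjT R m) (oddpi R) (ve m) (vf m).
  move=> rs even_s.
  have spanN r : zspan s r -> zspan s (- r).
    by rewrite -sub0r; apply: zspanB; apply: zspan0.
  have span r : r \in [:: r1; r2; r3] -> zspan s r.
    by move=> /rs[/mem_zspan //|/mem_zspan/spanN]; rewrite opprK.
  have [|tau tau_odd tau_cvg] := @odd_times R (zspan s)
      [:: r1; - r1; r2; - r2; r3; - r3] (zspan0 s) (@zspanB R s) even_s.
    have [s1 s2 s3] : [/\ zspan s r1, zspan s r2 & zspan s r3].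
      by split; apply: span; rewrite !inE eqxx ?orbT.
    by move=> t; rewrite !inE => /or4P[| | |/or3P[]] /eqP->; rewrite ?opprK; auto.
  exact: pgst_T2m r_lt e123 tau_odd tau_cvg.
split=> [q_irr|_ f th1 th2 th3 f_mon f_size f_irr Dq Df].
  apply: (transfer [:: r1; r2; r3]) => [r|c [l Dc]]; first by left.
  have := trace_relation (monic_q_T2m m) q_irr (size_q_T2m m) _ (esym Dc).
  (* [q] has no term of degree 5, so every integer in the span is zero. *)
  rewrite coef5_q_T2m mulr0 oppr0 => H.
  have /eqP : 6 * c%:~R = 0 :> rat.
    by apply: H => j; rewrite rootE q_T2mE qr // mem_nth.
  by rewrite mulf_eq0 /= intr_eq0 => /eqP->; exists 0.
pose fR := map_poly ratr f : {poly R}.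
have zE r : exists2 z : R, z = r \/ z = - r & r \in [:: r1; r2; r3] -> root fR z.
  have [rin|] := boolP (r \in _); last by exists r; [left|].
  have : root (map_poly ratr (q_T2m m)) r by rewrite rootE q_T2mE qr.
  rewrite Dq rmorphN rmorphM /= map_comp_poly rmorphN /= map_polyX rootN rootM.
  rewrite root_comp hornerN hornerX => /orP[fr|fr]; first by exists r; [left|].
  by exists (- r); [right|].
have [z1 z1E z1f] := zE r1; have [z2 z2E z2f] := zE r2; have [z3 z3E z3f] := zE r3.
rewrite !inE !eqxx ?orbT in z1f z2f z3f.
have zf z : z \in [:: z1; z2; z3] -> root fR z.
  by rewrite !inE => /or3P[] /eqP->; [apply: z1f | apply: z2f | apply: z3f].
(* The [th] lie in [algC] and the [z] in [R]; the rational coefficient of degree 2 of [f] carries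
   the sum from one field to the other. *)
have coef_sum (k : int) : th1 + th2 + th3 = k%:~R -> f`_2 = - k%:~R.
  move=> sum_th; apply: (fmorph_inj (ratr : rat -> algC)).
  by rewrite -coef_map /= Df coef2_prod_XsubC3 sum_th rmorphN /= ratr_int.
split=> [[k /coef_sum f2]|[k /coef_sum f2]].
  apply: (transfer [:: z1; z2; z3]) => [r|c [l Dc]].
    rewrite !inE => /or3P[] /eqP->.
    - by case: z1E => <-; [left | right]; rewrite ?eqxx.
    - by case: z2E => <-; [left | right]; rewrite ?eqxx ?orbT.
    - by case: z3E => <-; [left | right]; rewrite ?eqxx ?orbT.
  have := trace_relation f_mon f_irr f_size _ (esym Dc).
  rewrite f2 mulrN opprK => H.
  have {}H : 3 * c = (\sum_j l j) * (k *+ 2) :> int.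
    apply: (@intr_inj rat); rewrite !rmorphM /=; apply: H => j.
    by apply: zf; apply: mem_nth.
  (* From [3 c = 2 S k] follows [c = 2 (S k - c)]. *)
  by exists ((\sum_j l j) * k - c); move: H; move: (\sum_j l j) => S; lia.
(* The [z] have distinct absolute values, so they are all the roots of the cubic [f]. *)
have z_uniq : uniq [:: z1; z2; z3].
  rewrite /= !inE negb_or; case: z1E => ->; case: z2E => ->; case: z3E => ->;
  by apply/and3P; split => //; try (apply/andP; split); apply/eqP; lra.
have DfR : fR = ('X - z1%:P) * ('X - z2%:P) * ('X - z3%:P).
  rewrite (@all_roots_prod_XsubC _ fR [:: z1; z2; z3]).
  - rewrite lead_coef_map (monicP f_mon) rmorph1 scale1r.
    by rewrite !big_cons big_nil mulr1 mulrA.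
  - by rewrite size_map_poly f_size.
  - by apply/allP.
  - by rewrite uniq_rootsE.
have sumz : z1 + z2 + z3 = (k *+ 2 + 1)%:~R.
  apply: oppr_inj; rewrite -coef2_prod_XsubC3 -DfR coef_map /= f2.
  by rewrite rmorphN /= ratr_int.
move=> a b; apply: no_pgst_T2m sumz => // z zin.
have : root (map_poly ratr (q_T2m m)) z.
  by rewrite Dq rmorphN rmorphM /= rootN rootM zf.
by rewrite rootE q_T2mE => /eqP.
Qed.
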